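(* For every $\epsilon > 0$ there is a degree $D = D(\epsilon)$ and, for each $S$, a constant $C(\epsilon,S)$ such that the following holds. Suppose that $\mathfrak{L}$ is a set of $L$ lines in $\mathbb{R}^3$ with at most $S$ lines of $\mathfrak{L}$ contained in any algebraic surface of degree $D$. Then $$ |P_2(\mathfrak{L})| \le C(\epsilon, S)\, L^{(3/2)+\epsilon}. $$
   Context: $P_2(\mathfrak{L})$ denotes the set of $2$-rich points of $\mathfrak{L}$, i.e. the set of points of $\mathbb{R}^3$ that lie in at least two lines of $\mathfrak{L}$. An algebraic surface of degree $D$ is the zero set in $\mathbb{R}^3$ of a non-zero real polynomial of degree $D$. *)

(* Defs.v *)
From HB Require Import structures.
From mathcomp Require Import all_boot all_order all_algebra.
From mathcomp Require Import all_classical all_reals all_analysis.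
(* The notations of mpoly clash with those of mathcomp-analysis. *)
From mathcomp Require Import -(notations) mpoly.

Set Implicit Arguments.
Unset Strict Implicit.
Unset Printing Implicit Defensive.

Import Order.TTheory GRing.Theory Num.Theory.

Local Open Scope classical_set_scope.
Local Open Scope ring_scope.

Definition is_line (R : realType) (l : set 'rV[R]_3) : Prop :=
  exists a v : 'rV[R]_3, v != 0 /\ l = [set a + t *: v | t in [set: R]].

Definition zero_locus (R : realType) (p : mpoly 3 R) : set 'rV[R]_3 :=
  [set x | meval (fun i => x ord0 i) p = 0].

(* [mmeasure mdeg p] is what multinomials writes [msize p]: it is 1 plus the
   total degree of a non-zero p. *)
Definition algebraic_surface (R : realType) (D : nat) (Z : set 'rV[R]_3) :
    Prop :=
  exists p : mpoly 3 R,
    [/\ p != 0, mmeasure (@mdeg 3) p = D.+1 & Z = zero_locus p].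

Definition two_rich_points (R : realType) (Ls : set (set 'rV[R]_3)) :
    set 'rV[R]_3 :=
  [set x | exists l1 l2 : set 'rV[R]_3,
     [/\ Ls l1, Ls l2, l1 <> l2, l1 x & l2 x]].

(* Main.v *)
(** Induction on the number of lines.  A polynomial of degree [D ~ 18 * 2 ^ I]
    cuts space into [8 ^ I] cells, each with at most a fraction [8 ^ -I] of the
    points.  A line not contained in its zero set enters at most [D + 1] cells
    and meets the zero set in at most [D] points, while the at most [S] lines
    contained in the zero set account for at most [S ^ 2] points.  Hence a
    typical cell sees about [L / 4 ^ I] lines; applying the induction hypothesis
    in the cells loses a constant factor but gains [4 ^ (- I * eps)], which wins
    when [I] is large.

    The partitioning polynomial comes from the ham sandwich theorem for finite
    families of vectors, which is proved without topology.  For vectors in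
    general position coloured with [n] colours, each colour being used an odd
    number of times, a choice of one vector of each colour is halving when the
    hyperplane it spans bisects every colour class.  The parity of the number of
    halving choices does not change when a vector moves: whenever a set of
    [n + 1] vectors becomes dependent, at most two choices, differing by one
    vector, are affected, and they exchange their status or gain or lose it
    together.  For one explicit configuration there is exactly one halving
    choice.  An arbitrary family is the limit at [d = 0] of a family in general
    position depending polynomially on [d], and the corresponding hyperplanes
    have a limit, obtained by dividing by a power of [d]. *)
Require Import Defs.
From mathcomp Require Import all_boot all_order all_algebra all_fingroup finmap.
From mathcomp Require Import boolp zify ring lra.
(* The notations of mpoly clash with those of mathcomp-analysis. *)
From mathcomp Require Import -(notations) mpoly.

Set Implicit Arguments.
Unset Strict Implicit.
Unset Printing Implicit Defensive.

Import Order.TTheory GRing.Theory Num.Theory.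

Local Open Scope ring_scope.

(** * Polynomials near zero *)

Lemma poly_bounded_unit (R : realFieldType) (p : {poly R}) :
  exists2 M, 0 <= M & forall x, 0 <= x <= 1 -> `|p.[x]| <= M.
Proof.
elim/poly_ind: p => [|p c [M M0 IH]].
  by exists 0 => // x _; rewrite horner0 normr0.
exists (M + `|c|); first by rewrite addr_ge0.
move=> x /[dup] /IH hx /andP[x0 x1].
rewrite hornerMXaddC (le_trans (ler_normD _ _))// lerD2r normrM (ger0_norm x0).
by rewrite -[M]mulr1 ler_pM.
Qed.

Lemma poly_gt0_near0 (R : realFieldType) (p : {poly R}) : 0 < p.[0] ->
  exists2 d, 0 < d & forall x, 0 < x < d -> 0 < p.[x].
Proof.
elim/poly_ind: p => [|p c _]; first by rewrite horner0 ltxx.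
rewrite hornerMXaddC mulr0 add0r => c0.
have [M M0 hM] := poly_bounded_unit p.
have M1 : 0 < M + 1 by rewrite ltr_wpDl.
exists (Num.min 1 (c / (M + 1))); first by rewrite lt_min ltr01 divr_gt0.
move=> x /andP[x0]; rewrite lt_min ltr_pdivlMr// => /andP[x1 xc].
have /hM : 0 <= x <= 1 by rewrite !ltW.
rewrite ler_norml hornerMXaddC => /andP[h _]; nra.
Qed.

Lemma poly_neq0_near0 (R : realFieldType) (p : {poly R}) : p != 0 ->
  exists2 d, 0 < d & forall x, 0 < x < d -> p.[x] != 0.
Proof.
move=> p0; have [n [q /implyP/(_ p0) q0 ->]] := multiplicity_XsubC p 0.
rewrite rootE in q0.
(* The square has a positive value at 0 whatever the sign of [q.[0]]. *)
have [|d d0 hd] := @poly_gt0_near0 _ (q * q).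
  by rewrite hornerM lt_def mulf_neq0 //= -expr2 sqr_ge0.
exists d => // x /[dup] /hd + /andP[x0 _]; rewrite !hornerE.
have : x ^+ n != 0 by rewrite expf_neq0 // gt_eqF.
move=> xn; have [->|qx _] := eqVneq q.[x] 0; first by rewrite mul0r ltxx.
by rewrite subr0 mulf_neq0.
Qed.

Lemma eventually_all (R : realFieldType) (I : finType) (P : I -> R -> Prop) :
  (forall i, exists2 d, 0 < d & forall x, 0 < x < d -> P i x) ->
  exists2 d, 0 < d & forall x, 0 < x < d -> forall i, P i x.
Proof.
move=> h.
suff [d d0 hd] : exists2 d, 0 < d &
    forall x, 0 < x < d -> forall i, i \in enum I -> P i x.
  by exists d => // x /hd H i; apply: H; rewrite mem_enum.
elim: (enum I) => [|i s [d d0 hd]]; first by exists 1.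
have [e e0 he] := h i.
exists (Num.min d e); first by rewrite lt_min d0 e0.
move=> x /andP[x0]; rewrite lt_min => /andP[xd xe] j; rewrite inE => /orP[/eqP->|].
  by apply: he; rewrite x0.
by apply: hd; rewrite x0.
Qed.

Lemma poly_nonroot_itv (R : realFieldType) (p : {poly R}) (a b : R) :
  p != 0 -> a < b -> exists2 x, a < x < b & p.[x] != 0.
Proof.
move=> p0 ab.
have q0 : p \Po ('X + a%:P) != 0.
  by rewrite comp_poly_eq0 // size_XaddC.
have [d d0 hd] := poly_neq0_near0 q0.
pose m := Num.min d (b - a) / 2.
have m0 : 0 < m by rewrite divr_gt0 // lt_min d0 subr_gt0.
have [md mb] : m < d /\ m < b - a.
  have : m < Num.min d (b - a) by rewrite /m in m0 *; lra.
  by rewrite lt_min => /andP[].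
exists (a + m); first by apply/andP; split; lra.
have /hd : 0 < m < d by rewrite m0.
by rewrite horner_comp !hornerE addrC.
Qed.

(* Each [g k] vanishes on a proper subspace, and finitely many of these do not
   cover the space. *)
Lemma avoid_hyperplanes (R : realFieldType) (V : lmodType R) (I : finType)
    (P : pred I) (g : I -> V -> R) :
  (forall k, P k -> forall (t : R) u u', g k (u + t *: u') = g k u + t * g k u') ->
  (forall k, P k -> exists u, g k u != 0) ->
  exists u, forall k, P k -> g k u != 0.
Proof.
move=> lin nz.
suff [u hu] : exists u, forall k, k \in filter P (enum I) -> g k u != 0.
  by exists u => k Pk; rewrite hu // mem_filter Pk mem_enum.
elim: (enum I) => [|k r [u hu]] /=; first by exists 0.
case: ifP => Pk; last by exists u.
have [u' hu'] := nz k Pk.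
(* Each form is affine along [u + x *: u'], so for small [x > 0] it is nonzero as soon as it is
   nonzero at [u] or at [u']: the conditions already met persist, and that of [k] is gained. *)
have near i : exists2 d, 0 < d & forall x, 0 < x < d -> P i ->
    (g i u != 0) || (g i u' != 0) -> g i (u + x *: u') != 0.
  pose p := (g i u)%:P + g i u' *: 'X.
  have pE x : p.[x] = g i u + x * g i u' by rewrite !hornerE mulrC.
  have [/orP hi|//] := boolP ((g i u != 0) || (g i u' != 0)); last by exists 1.
  have [|d d0 hd] := @poly_neq0_near0 _ p.
    apply/eqP => p0; have := pE 0; have := pE 1.
    rewrite p0 !horner0 mul0r addr0 mul1r => + e; rewrite -e add0r => e'.
    by case: hi; rewrite -?e -?e' eqxx.
  by exists d => // x /hd + Pi; rewrite lin // pE.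
have [d d0 hd] := eventually_all near.
have d2 : 0 < d / 2 < d by lra.
exists (u + (d / 2) *: u') => i; rewrite inE => /predU1P[->|ir].
  by apply: hd => //; rewrite hu' orbT.
by apply: hd => //; rewrite ?hu //; move: ir; rewrite mem_filter => /andP[].
Qed.

(** * Brackets and general position *)

Definition bracket (R : comPzRingType) n (X : Type) (v : X -> 'rV[R]_n)
  (s : 'I_n -> X) : R := \det (\matrix_i v (s i)).

(* The choice [T] preceded by [z]: the bracket of [extend_row T z] is, up to a
   scalar, the linear form vanishing on the vectors chosen by [T], evaluated at
   the vector [z]. *)
Definition extend_row n (X : finType) (T : {ffun 'I_n -> X}) (z : X) :
  {ffun 'I_n.+1 -> X} := [ffun i => oapp T z (unlift ord0 i)].

Definition update (X : eqType) (A : Type) (v : X -> A) (y : X) (u : A) : X -> A :=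
  fun x => if x == y then u else v x.

Section Bracket.
Variables (R : comPzRingType) (n : nat) (X : finType).
Implicit Types (v w : X -> 'rV[R]_n) (s : {ffun 'I_n -> X}).

Lemma eq_bracket v w (s s' : 'I_n -> X) :
  (forall i, v (s i) = w (s' i)) -> bracket v s = bracket w s'.
Proof. by move=> e; congr (\det _); apply/row_matrixP => i; rewrite !rowK. Qed.

Lemma bracket_repeat v s i j : i != j -> v (s i) = v (s j) -> bracket v s = 0.
Proof.
by move=> ij e; apply: (determinant_alternate ij) => k; rewrite !mxE e.
Qed.

Lemma bracket_perm v s (p : 'S_n) :
  bracket v (s \o p) = (-1) ^+ p * bracket v s.
Proof.
rewrite -det_perm -det_mulmx -row_permE; congr (\det _).
by apply/matrixP => i j; rewrite !mxE.
Qed.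

(** As [s] is injective, the vector at [y] fills exactly one row of the determinant, which is linear
    in that row. *)
Lemma bracket_affine v w v' (s : {ffun 'I_n -> X}) (y : X) (a b : R) :
  injective s -> y \in codom s ->
  (forall x, x != y -> w x = v x) -> (forall x, x != y -> v' x = v x) ->
  v' y = a *: v y + b *: w y ->
  bracket v' s = a * bracket v s + b * bracket w s.
Proof.
move=> injs /codomP[i0 yE] hw hv' e.
have ne i : i != i0 -> s i != y.
  by move=> ii0; rewrite yE (inj_eq injs).
apply: (@determinant_multilinear _ _ _ _ _ i0); rewrite ?rowK -?yE //.
  by apply/row_matrixP => i; rewrite !row_rowsub !rowK hv'// ne // eq_sym neq_lift.
by apply/row_matrixP => i; rewrite !row_rowsub !rowK hv' ?hw // ne // eq_sym neq_lift.
Qed.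

End Bracket.

(** The generalized cross product of the rows of [A]. The zero row is a placeholder, since cofactors
    along row 0 do not see it. *)
Definition cofactors (R : comPzRingType) n (A : 'M[R]_(n, n.+1)) : 'cV[R]_n.+1 :=
  \col_j cofactor (col_mx (0 : 'rV_n.+1) A) 0 j.

Lemma bracket_extend (R : comPzRingType) n (X : finType) (v : X -> 'rV[R]_n.+1)
    (T : {ffun 'I_n -> X}) z :
  bracket v (extend_row T z) = (v z *m cofactors (\matrix_i v (T i))) 0 0.
Proof.
rewrite /bracket (expand_det_row _ 0) mxE; apply: eq_bigr => j _.
rewrite !mxE ffunE unlift_none /=; congr (_ * (_ * \det _)).
apply/matrixP => k l; do 2!rewrite [LHS]mxE [RHS]mxE.
have -> : lift ord0 k = rshift 1 k by apply: val_inj.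
by rewrite col_mxEd !mxE ffunE (_ : rshift 1 k = lift ord0 k) ?liftK //; apply: val_inj.
Qed.

Section Generic.
Variables (R : realFieldType) (n : nat) (X : finType).
Implicit Types (v w : X -> 'rV[R]_n.+1) (s : {ffun 'I_n.+1 -> X}) (y : X).

Definition generic v := forall s, injective s -> bracket v s != 0.

(* When only the vector at [y] moves along a segment from [v] to [w], two
   different [n.+1]-sets never become dependent at the same time. *)
Definition separated v w y := forall s s', injective s -> injective s' ->
  y \in codom s -> y \in codom s' -> ~~ (codom s \subset codom s') ->
  bracket v s * bracket w s' != bracket v s' * bracket w s.

Lemma bracket_update v y u s : y \notin codom s ->
  bracket (update v y u) s = bracket v s.
Proof.
move=> ys; apply: eq_bracket => i; rewrite /update.
by case: eqP ys => // <-; rewrite codom_f.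
Qed.

Lemma bracket_update_linear v y s (t : R) u u' : injective s -> y \in codom s ->
  bracket (update v y (u + t *: u')) s =
  bracket (update v y u) s + t * bracket (update v y u') s.
Proof.
move=> injs ys; rewrite -[X in _ = X + _]mul1r.
apply: (bracket_affine (y := y)) => //; rewrite /update ?eqxx ?scale1r //.
  by move=> x /negbTE ->.
by move=> x /negbTE ->.
Qed.

(** Serves to bring two configurations to the same vector [u] at [y], after which they differ at
    fewer points. Each requirement on [u] says that some nonzero linear form does not vanish at
    [u]. *)
Lemma generic_intermediate v v' y : generic v -> generic v' ->
  exists u, [/\ generic (update v y u), generic (update v' y u),
    separated v (update v y u) y & separated v' (update v' y u) y].
Proof.
move=> gv gv'.
pose V (b : bool) := if b then v else v'.
have gV b : generic (V b) by case: b.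
have VE b : update (V b) y (V b y) =1 V b.
  by move=> x; rewrite /update; case: eqP => // ->.
have brV b s : bracket (update (V b) y (V b y)) s = bracket (V b) s.
  by apply: eq_bracket => i; rewrite VE.
pose F : finType := {ffun 'I_n.+1 -> X}.
pose ok (s : F) := injectiveb s && (y \in codom s).
pose P (k : bool * (F + F * F)) := match k.2 with
  | inl s => ok s
  | inr (s, s') => [&& ok s, ok s' & ~~ (codom s \subset codom s')] end.
pose g (k : bool * (F + F * F)) u := match k.2 with
  | inl s => bracket (update (V k.1) y u) s
  | inr (s, s') => bracket (V k.1) s * bracket (update (V k.1) y u) s' -
      bracket (V k.1) s' * bracket (update (V k.1) y u) s end.
have [||u hu] := @avoid_hyperplanes _ 'rV[R]_n.+1 _ P g.
- move=> [b [s|[s s']]]; rewrite /P /g /=.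
    by move=> /andP[/injectiveP injs ys] *; apply: bracket_update_linear.
  move=> /and3P[/andP[/injectiveP injs ys] /andP[/injectiveP injs' ys'] _] t u u'.
  by rewrite !bracket_update_linear //; ring.
- move=> [b [s|[s s']]]; rewrite /P /g /=.
    by move=> /andP[/injectiveP injs ys]; exists (V b y); rewrite brV gV.
  move=> /and3P[/andP[/injectiveP injs ys] /andP[/injectiveP injs' ys']].
  (* With [p] in [s] but not in [s'], giving [y] the vector of [p] repeats a row in the bracket of
     [s], and turns that of [s'] into the bracket of another injective choice. *)
  case/subsetPn => p ps ps'; exists (V b p).
  have py : p != y by apply: contraNneq ps' => ->.
  have [i iE] := codomP ps; have [j jE] := codomP ys.
  rewrite (@bracket_repeat _ _ _ (update (V b) y (V b p)) s i j); last 2 first.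
  - by apply: contra_neq py => ij; rewrite iE ij -jE.
  - by rewrite /update -iE -jE eqxx (negbTE py).
  rewrite mulr0 subr0 mulf_neq0 ?gV //.
  have -> : bracket (update (V b) y (V b p)) s' =
      bracket (V b) [ffun k => if s' k == y then p else s' k].
    by apply: eq_bracket => k; rewrite /update ffunE; case: ifP.
  apply: gV => k l; rewrite !ffunE.
  case: (eqVneq (s' k) y) => ky; case: (eqVneq (s' l) y) => ly //.
  - by move=> _; apply: injs'; rewrite ky ly.
  - by move=> e; case/negP: ps'; rewrite e codom_f.
  - by move=> e; case/negP: ps'; rewrite -e codom_f.
  - exact: injs'.
have gen b : generic (update (V b) y u).
  move=> s injs; have [ys|ys] := boolP (y \in codom s).
    by apply: (hu (b, inl s)); rewrite /P /ok /= ys andbT; apply/injectiveP.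
  by rewrite bracket_update // gV.
have sep b : separated (V b) (update (V b) y u) y.
  move=> s s' injs injs' ys ys' ss'; rewrite -subr_eq0.
  apply: (hu (b, inr (s, s'))); rewrite /P /ok /= ys ys' ss' !andbT.
  by apply/andP; split; apply/injectiveP.
by exists u; split;
  [apply: (gen true)|apply: (gen false)|apply: (sep true)|apply: (sep false)].
Qed.

End Generic.

(** * Halving choices of vectors *)

Section Halving.
Variables (R : realFieldType) (n : nat) (X : finType) (c : X -> 'I_n).
Implicit Types (v w : X -> 'rV[R]_n.+1) (T : {ffun 'I_n -> X}) (y z : X).

Definition rainbow T := [forall i, c (T i) == i].

(** A sum of signs vanishes when as many vectors of the colour lie strictly on one side as on the
    other; the chosen vectors count for 0. *)
Definition halving v T := [forall i,
  \sum_(z | c z == i) Num.sg (bracket v (extend_row T z)) == 0].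

Definition num_halving v : nat := \sum_(T | rainbow T) halving v T.

Definition exchange T z : {ffun 'I_n -> X} := [ffun i => if i == c z then z else T i].

Lemma extend_row_inj T z : rainbow T -> T (c z) != z ->
  injective (extend_row T z).
Proof.
move=> /forallP tT zT i j; rewrite !ffunE.
case: (unliftP ord0 i) => [k|] ->; case: (unliftP ord0 j) => [l|] -> //=.
- by move=> /(congr1 c); rewrite (eqP (tT k)) (eqP (tT l)) => ->.
- by move=> e; case/eqP: zT; rewrite -[in c z]e (eqP (tT k)).
- by move=> e; case/eqP: zT; rewrite {1}e (eqP (tT l)).
Qed.

Lemma codom_extend_row T z x :
  (x \in codom (extend_row T z)) = (x == z) || (x \in codom T).
Proof.
apply/idP/orP.
  case/codomP => i ->; rewrite ffunE; case: unliftP => [k|] _ /=.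
    by right; rewrite codom_f.
  by left.
case=> [/eqP->|/codomP[k ->]]; apply/codomP.
  by exists ord0; rewrite ffunE unlift_none.
by exists (lift ord0 k); rewrite ffunE liftK.
Qed.

(** The vectors of [extend_row T z] contain one of each colour, except for two of colour [c z]. A
    rainbow choice among them leaves out one of these two, hence the two cases. *)
Lemma codom_extend_rowP T z T' z' : rainbow T -> rainbow T' ->
  T (c z) != z -> codom (extend_row T z) \subset codom (extend_row T' z') ->
  (T', z') = (T, z) \/ (T', z') = (exchange T z, T (c z)).
Proof.
move=> /forallP tT /forallP tT' zT /subsetP sub.
have inT' x : x \in codom (extend_row T z) -> x = z' \/ x = T' (c x).
  move=> /sub; rewrite codom_extend_row => /orP[/eqP->|/codomP[k ->]]; first by left.
  by right; rewrite (eqP (tT' k)).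
have hT i : T i = z' \/ T i = T' i.
  have := inT' (T i); rewrite codom_extend_row codom_f orbT (eqP (tT i)); exact.
have hz : z = z' \/ z = T' (c z).
  by apply: inT'; rewrite codom_extend_row eqxx.
have cz : c z' = c z.
  case: hz => [->//|zE]; case: (hT (c z)) => [<-|e]; first by rewrite (eqP (tT _)).
  by case/eqP: zT; rewrite e.
have other i : i != c z -> T' i = T i.
  by move=> ic; case: (hT i) => // e; case/eqP: ic; rewrite -cz -e (eqP (tT i)).
case: hz => [zE|zE].
  left; congr pair => //; apply/ffunP => i.
  case: (eqVneq i (c z)) => [->|/other//]; case: (hT (c z)) => // e.
  by case/eqP: zT; rewrite e.
right; congr pair; last first.
  by case: (hT (c z)) => // e; case/eqP: zT; rewrite e -zE.
by apply/ffunP => i; rewrite ffunE; case: eqP => [->//|/eqP/other].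
Qed.

Lemma rainbow_exchange T z : rainbow T -> rainbow (exchange T z).
Proof.
by move=> /forallP tT; apply/forallP => i; rewrite ffunE; case: ifP => [/eqP->//|_].
Qed.

Lemma bracket_exchange v T z :
  bracket v (extend_row (exchange T z) (T (c z))) = - bracket v (extend_row T z).
Proof.
pose p := tperm ord0 (lift ord0 (c z)).
transitivity (bracket v (extend_row T z \o p)).
  apply: eq_bracket => i; rewrite /= ffunE /p.
  case: unliftP => [k|] -> /=; last by rewrite tpermL ffunE liftK.
  rewrite ffunE; case: eqP => [->|kc]; first by rewrite tpermR ffunE unlift_none.
  rewrite tpermD ?ffunE ?liftK ?neq_lift //.
  by rewrite (inj_eq lift_inj); apply/eqP => e; apply: kc.
by rewrite bracket_perm odd_tperm neq_lift expr1 mulN1r.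
Qed.

Lemma bracket_extend_repeat v T k : bracket v (extend_row T (T k)) = 0.
Proof.
apply: (@bracket_repeat _ _ _ _ _ ord0 (lift ord0 k)); rewrite ?neq_lift //.
by rewrite !ffunE unlift_none liftK.
Qed.

(* In [z], both sides are linear forms vanishing on the vectors chosen by [T'],
   and they agree at [p]. *)
Lemma bracket_proportional v T T' p :
  bracket v (extend_row T' p) != 0 ->
  (forall k, bracket v (extend_row T (T' k)) = 0) ->
  forall z, bracket v (extend_row T z) * bracket v (extend_row T' p) =
    bracket v (extend_row T p) * bracket v (extend_row T' z).
Proof.
move=> nz h0 z; rewrite !bracket_extend.
set K := cofactors _; set K' := cofactors _.
pose M := \matrix_i v (extend_row T' p i).
have uM : M \in unitmx by rewrite unitmxE unitfE.
have MK (T1 : {ffun 'I_n -> X}) :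
  (forall k, bracket v (extend_row T1 (T' k)) = 0) ->
  M *m cofactors (\matrix_i v (T1 i)) =
  \col_i (if i == ord0 then bracket v (extend_row T1 p) else 0).
  move=> h; apply/matrixP => i j; rewrite (ord1 j) mxE [RHS]mxE.
  transitivity (bracket v (extend_row T1 (extend_row T' p i))).
    by rewrite bracket_extend mxE; apply: eq_bigr => l _; rewrite mxE.
  rewrite ffunE; case: unliftP => [k|] -> /=; last by [].
  by rewrite h.
have e : bracket v (extend_row T' p) *: K = bracket v (extend_row T p) *: K'.
  apply: (can_inj (mulKmx uM)); rewrite -!scalemxAr !MK //; last first.
    by move=> k; rewrite bracket_extend_repeat.
  by apply/matrixP => i j; rewrite !mxE; case: eqP; rewrite ?mulr0 // mulrC.
have /= := congr1 (fun A => (v z *m A) 0 0) e.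
by rewrite -!scalemxAr [X in X = _ -> _]mxE [X in _ = X -> _]mxE mulrC !bracket_extend.
Qed.

(** The transposition preserves colours, so it permutes the terms of each sum, and a nonzero factor
    does not affect its vanishing. *)
Lemma eq_halving_tperm v w T T' a b (k : R) : c a = c b -> k != 0 ->
  (forall z, Num.sg (bracket w (extend_row T' z)) =
     k * Num.sg (bracket v (extend_row T (tperm a b z)))) ->
  halving w T' = halving v T.
Proof.
move=> cab k0 e; apply: eq_forallb => i.
rewrite [in RHS](reindex_inj (@perm_inj _ (tperm a b))) /=.
rewrite (eq_bigr _ (fun z _ => e z)) -mulr_sumr mulf_eq0 (negbTE k0) /=.
congr (_ == _); apply: eq_bigl => z.
by case: tpermP => [->|->|//]; rewrite cab.
Qed.

Section OneEvent.
Variables (v w u : X -> 'rV[R]_n.+1) (T0 : {ffun 'I_n -> X}) (b : X).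
Let a := T0 (c b).
Let T1 := exchange T0 b.
Hypotheses (tT0 : rainbow T0) (ab : a != b).
Hypothesis same_sg : forall T z, rainbow T -> (T, z) != (T0, b) ->
  (T, z) != (T1, a) ->
  Num.sg (bracket v (extend_row T z)) = Num.sg (bracket u (extend_row T z)) /\
  Num.sg (bracket w (extend_row T z)) = Num.sg (bracket u (extend_row T z)).
Hypothesis u_generic : forall z, z != a -> z != b -> z \notin codom T0 ->
  bracket u (extend_row T0 z) != 0 /\ bracket u (extend_row T1 z) != 0.
Hypothesis event : bracket u (extend_row T0 b) = 0.
Hypothesis flip : Num.sg (bracket w (extend_row T0 b)) =
  - Num.sg (bracket v (extend_row T0 b)).

(* Only [T0] and [T1] are affected.  Near the event their hyperplanes agree away
   from [a] and [b], up to a sign [k]: if [k = 1] the two choices exchange their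
   status, and if [k = -1] they have the same status before and after. *)
Lemma odd_num_halving_event : odd (num_halving v) = odd (num_halving w).
Proof.
have tT1 : rainbow T1 by exact: rainbow_exchange.
have ca : c a = c b by apply/eqP/(forallP tT0).
have T10 : T1 != T0.
  by apply: contraNneq ab => /ffunP/(_ (c b)); rewrite /a /T1 ffunE eqxx => <-.
have T1b : T1 (c b) = b by rewrite /T1 ffunE eqxx.
have swapE (x : X -> 'rV[R]_n.+1) : bracket x (extend_row T1 a) = - bracket x (extend_row T0 b).
  exact: bracket_exchange.
have codT1 z : z != a -> z != b -> (z \in codom T1) = (z \in codom T0).
  move=> za zb; apply/codomP/codomP => -[k]; rewrite /T1 ?ffunE => e; exists k;
    rewrite ?ffunE //; move: e; case: eqP => // kc e.
    by case/eqP: zb.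
  by case/eqP: za; rewrite e kc.
have zero0 (x : X -> 'rV[R]_n.+1) z : z \in codom T0 -> bracket x (extend_row T0 z) = 0.
  by case/codomP => k ->; exact: bracket_extend_repeat.
have zero1 (x : X -> 'rV[R]_n.+1) z : z \in codom T1 -> bracket x (extend_row T1 z) = 0.
  by case/codomP => k ->; exact: bracket_extend_repeat.
have a0 (x : X -> 'rV[R]_n.+1) : bracket x (extend_row T0 a) = 0 by rewrite zero0 // codom_f.
have b1 (x : X -> 'rV[R]_n.+1) : bracket x (extend_row T1 b) = 0.
  by rewrite zero1 // -[X in X \in _]T1b codom_f.
(* At the event the two hyperplanes coincide, so [k] is the sign of the ratio of their forms, read
   off at any [p] outside both choices. If there is no such [p], all signs concerned are 0 and
   [k = 1] will do. *)
have [k k1 hk] : exists2 k : R, (k == 1) || (k == -1) & forall z, z != a -> z != b ->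
    Num.sg (bracket u (extend_row T1 z)) = k * Num.sg (bracket u (extend_row T0 z)).
  have [/existsP[p /and3P[pa pb pT0]]|] :=
      boolP [exists p, [&& p != a, p != b & p \notin codom T0]]; last first.
    rewrite negb_exists => /forallP h; exists 1; rewrite ?eqxx // => z za zb.
    have := h z; rewrite za zb negbK /= => zT.
    by rewrite zero0 // zero1 ?codT1 // mul1r.
  have [n0 n1] := u_generic pa pb pT0.
  have h0 i : bracket u (extend_row T0 (T1 i)) = 0.
    by rewrite /T1 ffunE; case: eqP => // _; rewrite bracket_extend_repeat.
  exists (Num.sg (bracket u (extend_row T0 p)) * Num.sg (bracket u (extend_row T1 p))).
    by rewrite -sgrM sgr_def mulf_neq0 // mulr1n;
      case: (_ < 0); rewrite ?expr0 ?expr1 eqxx ?orbT.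
  move=> z za zb; have := congr1 Num.sg (bracket_proportional n1 h0 z).
  rewrite !sgrM => e; rewrite -mulrA [X in _ * X]mulrC e mulrA.
  by rewrite -expr2 sqr_sg n0 mul1r.
have sg0 x z : x = v \/ x = w -> z != b ->
    Num.sg (bracket x (extend_row T0 z)) = Num.sg (bracket u (extend_row T0 z)).
  move=> xE zb; have [||e1 e2] := same_sg (T := T0) (z := z) tT0.
  - by rewrite xpair_eqE negb_and zb orbT.
  - by rewrite xpair_eqE negb_and eq_sym T10.
  by case: xE => ->.
have sg1 x z : x = v \/ x = w -> z != a ->
    Num.sg (bracket x (extend_row T1 z)) = Num.sg (bracket u (extend_row T1 z)).
  move=> xE za; have [||e1 e2] := same_sg (T := T1) (z := z) tT1.
  - by rewrite xpair_eqE negb_and T10.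
  - by rewrite xpair_eqE negb_and za orbT.
  by case: xE => ->.
have rest : (\sum_(T | rainbow T && (T != T0) && (T != T1)) halving v T =
    \sum_(T | rainbow T && (T != T0) && (T != T1)) halving w T)%N.
  apply: eq_bigr => T /andP[/andP[tT n0] n1]; congr nat_of_bool.
  apply: eq_forallb => i; congr (_ == _); apply: eq_bigr => z _.
  have [||-> ->//] := same_sg (T := T) (z := z) tT.
    by rewrite xpair_eqE negb_and n0.
  by rewrite xpair_eqE negb_and n1.
(* Exchanging [a] and [b] carries the signs seen by [T0] to those seen by [T1]: by antisymmetry at
   [a] and [b], by the factor [k] elsewhere. For [k = 1] this is used with [x] and [x'] on opposite
   sides of the event, for [k = -1] with [x = x']. *)
have core x x' (e : R) : (x = v \/ x = w) -> (x' = v \/ x' = w) ->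
   Num.sg (bracket x' (extend_row T0 b)) = - e * Num.sg (bracket x (extend_row T0 b)) ->
   e = k -> halving x' T1 = halving x T0.
  move=> hx hx' he ek; apply: (@eq_halving_tperm _ _ _ _ a b k) => //.
    by case/orP: k1 => /eqP->; rewrite ?oppr_eq0 oner_eq0.
  move=> z; case: tpermP => [->|->|/eqP za /eqP zb].
  - by rewrite swapE sgrN he ek mulNr opprK.
  - by rewrite a0 b1 sgr0 mulr0.
  - by rewrite sg0 // sg1 // hk.
rewrite /num_halving (bigD1 T0) //= (bigD1 T1) ?tT1 //=.
rewrite [in RHS](bigD1 T0) //= [in RHS](bigD1 T1) ?tT1 //= rest !addnA !oddD.
congr (_ (+) _); rewrite !oddb.
case/orP: k1 => /eqP kE.
  rewrite (core v w 1) ?(core w v 1) //;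
    [exact: addbC|by right|by left| |by left|by right|].
    by rewrite flip mulNr mul1r opprK.
  by rewrite flip mulNr mul1r.
rewrite (core v v (-1)) ?(core w w (-1)) //; try by [left|right].
- by rewrite !addbb.
- by rewrite opprK mul1r.
- by rewrite opprK mul1r.
Qed.

End OneEvent.

End Halving.

(** * Invariance of the parity *)

Section SignOfAffine.
Variables (R : realFieldType) (p q t : R).
Hypothesis t01 : 0 < t < 1.

Lemma sgr_affine_same : Num.sg p = Num.sg q ->
  Num.sg ((1 - t) * p + t * q) = Num.sg p.
Proof.
case/andP: t01 => t0 t1; case: (sgrP q) => [->|q0|q0].
- by move/eqP; rewrite sgr_eq0 => /eqP ->; rewrite !mulr0 addr0 sgr0.
- move/eqP; rewrite sgr_cp0 => p0; rewrite [RHS]gtr0_sg // gtr0_sg //; nra.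
- move/eqP; rewrite sgr_cp0 => p0; rewrite [RHS]ltr0_sg // ltr0_sg //; nra.
Qed.

Variable r : R.
Hypotheses (r01 : 0 < r < 1) (pq : (1 - r) * p + r * q = 0).

(** Multiplying by [r] and eliminating [q] by means of [pq] leaves a positive multiple of [p]. *)
Lemma sgr_affine_before : t < r -> Num.sg ((1 - t) * p + t * q) = Num.sg p.
Proof.
case/andP: r01 => r0 _ tr.
rewrite -[LHS]mul1r -{1}(gtr0_sg r0) -sgrM (_ : r * _ = (r - t) * p).
  by rewrite sgrM gtr0_sg ?mul1r // subr_gt0.
by have := congr1 ( *%R t) pq; lra.
Qed.

Lemma sgr_affine_after : r < t -> Num.sg ((1 - t) * p + t * q) = Num.sg q.
Proof.
case/andP: r01 => _ r1 tr; have r1' : 0 < 1 - r by rewrite subr_gt0.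
rewrite -[LHS]mul1r -{1}(gtr0_sg r1') -sgrM (_ : (1 - r) * _ = (t - r) * q).
  by rewrite sgrM gtr0_sg ?mul1r // subr_gt0.
by have := congr1 ( *%R (1 - t)) pq; lra.
Qed.

End SignOfAffine.

Lemma affine_root (R : realFieldType) (p q : R) : p != 0 -> q != 0 ->
  Num.sg p != Num.sg q ->
  let r := p / (p - q) in
  [/\ 0 < r < 1, (1 - r) * p + r * q = 0 & Num.sg q = - Num.sg p].
Proof.
move=> p0 q0 pq r.
have pqs : p - q != 0 by rewrite subr_eq0; apply: contraNneq pq => ->.
have eq0 : (1 - r) * p + r * q = 0 by rewrite /r; field.
have sgpq : Num.sg q = - Num.sg p.
  by move: p0 q0 pq; case: (sgrP p) => // _; case: (sgrP q) => //; rewrite ?eqxx ?opprK.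
split=> //.
move: p0 q0 pqs sgpq; rewrite /r; case: (ltrgtP p 0) => // hp _;
  case: (ltrgtP q 0) => // hq _ pqs.
- by rewrite !ltr0_sg // => h; exfalso; lra.
- move=> _; have h : p - q < 0 by lra.
  by rewrite ltr_ndivlMr // ltr_ndivrMr // mul0r mul1r hp /=; lra.
- move=> _; have h : 0 < p - q by lra.
  by rewrite ltr_pdivlMr // ltr_pdivrMr // mul0r mul1r hp /=; lra.
- by rewrite !gtr0_sg // => h; exfalso; lra.
Qed.

Definition segment (R : pzRingType) (V : lmodType R) (X : Type) (v w : X -> V) (t : R) :=
  fun x => (1 - t) *: v x + t *: w x.

Section Path.
Variables (R : realFieldType) (n : nat) (X : finType) (c : X -> 'I_n).
Implicit Types (v w : X -> 'rV[R]_n.+1) (T : {ffun 'I_n -> X}) (y z : X).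

Lemma bracket_segment v w y t (s : {ffun 'I_n.+1 -> X}) : injective s ->
  (forall x, x != y -> w x = v x) ->
  bracket (segment v w t) s = (1 - t) * bracket v s + t * bracket w s.
Proof.
move=> injs vw; have [ys|ys] := boolP (y \in codom s).
  apply: (bracket_affine (y := y)) => // x xy.
  by rewrite /segment vw // -scalerDl subrK scale1r.
have sy i : s i != y by apply: contraNneq ys => <-; rewrite codom_f.
have -> : bracket w s = bracket v s by apply: eq_bracket => i; rewrite vw.
rewrite -mulrDl subrK mul1r; apply: eq_bracket => i.
by rewrite /segment vw // -scalerDl subrK scale1r.
Qed.

Definition changed v w := [set e : {ffun 'I_n -> X} * X | rainbow c e.1 &&
  (Num.sg (bracket v (extend_row e.1 e.2)) != Num.sg (bracket w (extend_row e.1 e.2)))].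

Lemma changed_proper v w T z : (T, z) \in changed v w -> T (c z) != z.
Proof.
rewrite inE => /andP[_]; apply: contraNneq => /= zT.
by rewrite -[in X in Num.sg X]zT -[in X in _ == Num.sg X]zT !bracket_extend_repeat.
Qed.

Lemma changed_inj v w e : e \in changed v w -> injective (extend_row e.1 e.2).
Proof.
case: e => T z h; apply: (extend_row_inj (c := c)) (changed_proper h).
by move: h; rewrite inE => /andP[].
Qed.

Lemma changed_codom v w y e : (forall x, x != y -> w x = v x) ->
  e \in changed v w -> y \in codom (extend_row e.1 e.2).
Proof.
move=> vw; rewrite inE => /andP[_]; apply: contraNT => ys.
rewrite (@eq_bracket _ _ _ w v _ (extend_row e.1 e.2)) // => i; rewrite vw //.
by apply: contraNneq ys => <-; rewrite codom_f.
Qed.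

(** The product of all brackets is a polynomial in the time. It is nonzero at time 0, hence has a
    non-root in every interval. *)
Lemma generic_segment v w y a b : generic v -> (forall x, x != y -> w x = v x) ->
  a < b -> exists2 t, a < t < b & generic (segment v w t).
Proof.
move=> gv vw ab.
pose P := \prod_(s : {ffun 'I_n.+1 -> X} | injectiveb s)
  ((bracket v s)%:P + (bracket w s - bracket v s) *: 'X).
have PE t : P.[t] = \prod_(s : {ffun 'I_n.+1 -> X} | injectiveb s)
    (bracket v s + (bracket w s - bracket v s) * t).
  by rewrite horner_prod; apply: eq_bigr => s _; rewrite !hornerE.
have P0 : P != 0.
  apply/eqP => P0; have := PE 0; rewrite P0 horner0 => /esym/eqP; apply/negP.
  apply/prodf_neq0 => s /injectiveP injs.
  by rewrite mulr0 addr0 gv.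
have [t tab] := poly_nonroot_itv P0 ab.
rewrite PE => /prodf_neq0 h; exists t => // s injs.
have := h s (introT (injectiveP _) injs).
by rewrite (bracket_segment _ injs vw); congr (_ != _); ring.
Qed.

(* Induction on the number of sign changes: the segment is cut between two
   events until at most one event is left. *)
Lemma odd_num_halving_path v w y : generic v -> generic w ->
  (forall x, x != y -> w x = v x) -> separated v w y ->
  odd (num_halving c v) = odd (num_halving c w).
Proof.
move: {2}#|_|.+1 (ltnSn #|changed v w|) => m.
elim: m v w => // m IH v w; rewrite ltnS => cm gv gw vw sep.
(* The time at which the bracket of [e], affine along the segment, vanishes. *)
pose tm (e : {ffun 'I_n -> X} * X) := bracket v (extend_row e.1 e.2) /
  (bracket v (extend_row e.1 e.2) - bracket w (extend_row e.1 e.2)).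
have tmP e : e \in changed v w -> [/\ 0 < tm e < 1,
    (1 - tm e) * bracket v (extend_row e.1 e.2) + tm e * bracket w (extend_row e.1 e.2) = 0
    & Num.sg (bracket w (extend_row e.1 e.2)) = - Num.sg (bracket v (extend_row e.1 e.2))].
  move=> /[dup]/changed_inj injs; rewrite inE => /andP[_].
  by apply: affine_root; rewrite ?gv ?gw.
(* Two events on different sets of vectors happen at different times, by separation. A cut at a
   generic time [t] between them leaves fewer events on each half. *)
have [|] := boolP [exists e in changed v w, exists e' in changed v w,
    ~~ (codom (extend_row e.1 e.2) \subset codom (extend_row e'.1 e'.2))].
  case/exists_inP => e1 he1 /exists_inP[e2 he2 he12].
  have inj1 := changed_inj he1; have inj2 := changed_inj he2.
  have y1 := changed_codom vw he1; have y2 := changed_codom vw he2.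
  have [t1 r1 _] := tmP _ he1; have [t2 r2 _] := tmP _ he2.
  have t12 : tm e1 != tm e2.
    apply: contraNneq (sep _ _ inj1 inj2 y1 y2 he12) => t12; apply/eqP.
    move: r1 r2 t1 t2; rewrite -t12; move: (tm e1) => t.
    set p := bracket v _; set p' := bracket w _;
    set q := bracket v _; set q' := bracket w _.
    move=> r1 r2 /andP[t0 _] _; apply: (mulfI (lt0r_neq0 t0)).
    apply/eqP; rewrite -subr_eq0; apply/eqP.
    transitivity (p * ((1 - t) * q + t * q') - q * ((1 - t) * p + t * p')); first by ring.
    by rewrite r1 r2 !mulr0 subrr.
  have [t [t01 gu [a [b [ha hb ta tb]]]]] : exists t, [/\ 0 < t < 1,
      generic (segment v w t) & exists a b, [/\ a \in changed v w,
      b \in changed v w, tm a < t & t < tm b]].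
    case: (ltgtP (tm e1) (tm e2)) t12 => // lt12 _.
      have [t /andP[h1 h2] gt] := generic_segment gv vw lt12.
      by exists t; split=> //; [apply/andP; split; lra|exists e1, e2].
    have [t /andP[h1 h2] gt] := generic_segment gv vw lt12.
    by exists t; split=> //; [apply/andP; split; lra|exists e2, e1].
  have [t0 t1'] := andP t01.
  set u := segment v w t in gu.
  have uE (s : {ffun 'I_n.+1 -> X}) : injective s ->
      bracket u s = (1 - t) * bracket v s + t * bracket w s.
    by move=> injs; rewrite (bracket_segment _ injs vw).
  have vu x : x != y -> u x = v x.
    by move=> xy; rewrite /u /segment vw // -scalerDl subrK scale1r.
  have uw x : x != y -> w x = u x by move=> xy; rewrite vw // vu.
  have sub1 : changed v u \subset changed v w.
    apply/subsetP => e he; have inje := changed_inj he.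
    move: he; rewrite !inE uE // => /andP[-> /=]; apply: contraNneq => e'.
    by rewrite sgr_affine_same.
  have sub2 : changed u w \subset changed v w.
    apply/subsetP => e he; have inje := changed_inj he.
    move: he; rewrite !inE uE // => /andP[-> /=]; apply: contraNneq => e'.
    by rewrite sgr_affine_same // e'.
  have odd_vu : odd (num_halving c v) = odd (num_halving c u).
    apply: IH => //.
      apply: leq_trans cm; apply: proper_card; rewrite properE sub1.
      apply/subsetPn; exists b => //; rewrite inE negb_and negbK orbC.
      have [rb pb _] := tmP _ hb.
      by rewrite (uE _ (changed_inj hb)) (sgr_affine_before rb pb tb) eqxx.
    (* Separation passes to both halves: the difference of products is multiplied by [t] on the
       first one and by [1 - t] on the second one. *)
    move=> s s' injs injs' ys ys' ss'; rewrite !uE // -subr_eq0.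
    have := sep _ _ injs injs' ys ys' ss'; rewrite -subr_eq0 => h.
    rewrite (_ : _ - _ = t * (bracket v s * bracket w s' - bracket v s' * bracket w s)).
      by rewrite mulf_neq0 // gt_eqF.
    by ring.
  rewrite odd_vu; apply: IH => //.
    apply: leq_trans cm; apply: proper_card; rewrite properE sub2.
    apply/subsetPn; exists a => //; rewrite inE negb_and negbK orbC.
    have [ra pa _] := tmP _ ha.
    by rewrite (uE _ (changed_inj ha)) (sgr_affine_after ra pa ta) eqxx.
  move=> s s' injs injs' ys ys' ss'; rewrite !uE // -subr_eq0.
  have := sep _ _ injs injs' ys ys' ss'; rewrite -subr_eq0 => h.
  rewrite (_ : _ - _ = (1 - t) * (bracket v s * bracket w s' - bracket v s' * bracket w s)).
    by rewrite mulf_neq0 // subr_eq0 eq_sym lt_eqF.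
  by ring.
(* Now all events live on the same set of vectors, so by [codom_extend_rowP] only [(T0, b)] and its
   exchange can occur. *)
rewrite negb_exists_in => /forall_inP nA.
have {nA} sub e e' : e \in changed v w -> e' \in changed v w ->
    codom (extend_row e.1 e.2) \subset codom (extend_row e'.1 e'.2).
  by move=> /nA; rewrite negb_exists_in => /forall_inP h /h; rewrite negbK.
have [ch0|[[T0 b] h0]] := set_0Vmem (changed v w).
  congr odd; apply: eq_bigr => T tT; congr nat_of_bool; apply: eq_forallb => i.
  congr (_ == _); apply: eq_bigr => z _; apply/eqP.
  have : (T, z) \notin changed v w by rewrite ch0 inE.
  by rewrite inE tT /= negbK.
have [/= t01 r0 flip] := tmP _ h0; set t := tm _ in t01 r0.
have tT0 : rainbow c T0 by move: h0; rewrite inE => /andP[].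
have ab := changed_proper h0.
have T1T0 : exchange c T0 b != T0.
  by apply: contraNneq ab => /ffunP/(_ (c b)); rewrite ffunE eqxx => <-.
have same T z : rainbow c T -> (T, z) != (T0, b) ->
    (T, z) != (exchange c T0 b, T0 (c b)) ->
    Num.sg (bracket v (extend_row T z)) = Num.sg (bracket (segment v w t) (extend_row T z)) /\
    Num.sg (bracket w (extend_row T z)) = Num.sg (bracket (segment v w t) (extend_row T z)).
  move=> tT n0 n1.
  have [zT|zT] := eqVneq (T (c z)) z; first by rewrite -zT !bracket_extend_repeat.
  have injs := extend_row_inj tT zT.
  have e : Num.sg (bracket v (extend_row T z)) = Num.sg (bracket w (extend_row T z)).
    apply/eqP; apply/negPn; apply/negP => ch.
    have hTz : (T, z) \in changed v w by rewrite inE tT ch.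
    have := codom_extend_rowP tT0 tT ab (sub _ _ h0 hTz).
    by case=> e; rewrite -e eqxx in n0 n1.
  by rewrite (bracket_segment _ injs vw) sgr_affine_same.
apply: (odd_num_halving_event (u := segment v w t) tT0 ab same) => //.
  move=> z za zb zT0.
  have nz T : rainbow c T -> (T, z) != (T0, b) ->
      (T, z) != (exchange c T0 b, T0 (c b)) -> z \notin codom T ->
      bracket (segment v w t) (extend_row T z) != 0.
    move=> tT n0 n1 zT; have [e _] := same _ _ tT n0 n1.
    rewrite -sgr_eq0 -e sgr_eq0; apply: gv.
    by apply: (extend_row_inj tT); apply: contraNneq zT => <-; rewrite codom_f.
  split; apply: nz => //; rewrite ?xpair_eqE ?negb_and ?zb ?za ?orbT //.
  - exact: rainbow_exchange.
  - apply/codomP => -[k]; rewrite ffunE; case: eqP => _ e; first by case/eqP: zb.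
    by case/negP: zT0; rewrite e codom_f.
by rewrite (bracket_segment _ (changed_inj h0) vw).
Qed.

Lemma odd_num_halving_generic v w : generic v -> generic w ->
  odd (num_halving c v) = odd (num_halving c w).
Proof.
move: {2}#|_|.+1 (ltnSn #|[pred x | v x != w x]|) => m.
elim: m v w => // m IH v w; rewrite ltnS => cm gv gw.
have [/existsP[y yvw]|] := boolP [exists y, v y != w y]; last first.
  rewrite negb_exists => /forallP h; congr odd; apply: eq_bigr => T _.
  congr nat_of_bool; apply: eq_forallb => i; congr (_ == _); apply: eq_bigr => z _.
  by congr Num.sg; apply: eq_bracket => k; apply/eqP;
    have := h (extend_row T z k); rewrite negbK.
have [u [gv' gw' sv sw]] := generic_intermediate y gv gw.
have upd (f : X -> 'rV[R]_n.+1) x : x != y -> update f y u x = f x.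
  by rewrite /update => /negbTE ->.
rewrite (odd_num_halving_path gv gv' (upd v) sv) (odd_num_halving_path gw gw' (upd w) sw).
apply: IH => //; apply: leq_trans cm; apply: proper_card.
rewrite properE; apply/andP; split.
  apply/subsetP => x; rewrite !inE /update; case: (eqVneq x y) => [->|//].
  by rewrite eqxx.
by apply/subsetPn; exists y; rewrite ?inE // /update !eqxx.
Qed.

End Path.

(** * A configuration with one halving choice *)

Lemma poly_sg_near0 (R : realFieldType) (p : {poly R}) :
  exists2 d, 0 < d & forall x y, 0 < x < d -> 0 < y < d ->
    Num.sg p.[x] = Num.sg p.[y].
Proof.
have [->|p0] := eqVneq p 0; first by exists 1 => // x y _ _; rewrite !horner0.
have [n [q /implyP/(_ p0) q0 ->]] := multiplicity_XsubC p 0.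
rewrite rootE in q0.
have pos (q' : {poly R}) : 0 < q'.[0] -> exists2 d, 0 < d &
    forall x, 0 < x < d -> Num.sg (q' * ('X - 0%:P) ^+ n).[x] = 1.
  move=> /poly_gt0_near0[d d0 hd]; exists d => // x hx.
  have /andP[x0 _] := hx.
  by rewrite !hornerE subr0 gtr0_sg // mulr_gt0 ?hd // exprn_gt0.
case: (ltrgtP q.[0] 0) q0 => // q0 _.
  have [|d d0 hd] := pos (- q); first by rewrite hornerN oppr_gt0.
  exists d => // x y /hd hx /hd hy.
  by apply: oppr_inj; rewrite -!sgrN -!hornerN -!mulNr hx hy.
have [d d0 hd] := pos q q0; exists d => // x y /hd hx /hd hy.
by rewrite hx hy.
Qed.

Lemma sum_sgr (R : realDomainType) (I : finType) (P : pred I) (F : I -> R) :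
  \sum_(i | P i) Num.sg (F i) =
  #|[set i | P i & 0 < F i]|%:R - #|[set i | P i & F i < 0]|%:R.
Proof.
rewrite -!sum1dep_card !natr_sum /=.
rewrite big_mkcondr [X in _ - X]big_mkcondr -sumrB; apply: eq_bigr => i _.
by case: sgrP; rewrite ?subr0 ?sub0r ?ltxx.
Qed.

(** The rank within [A] is injective, so it takes every value below [#|A|]; an element is balanced
    exactly when its rank is [#|A|./2]. *)
Lemma unique_median (X : finType) (s : X -> nat) (A : {set X}) :
  injective s -> odd #|A| -> exists2 x, x \in A & forall y, y \in A ->
  (#|[set z in A | s y < s z]| == #|[set z in A | s z < s y]|)%N = (y == x).
Proof.
move=> injs oddA.
pose r y := #|[set z in A | (s z < s y)%N]|.
have gtE y : y \in A -> (#|[set z in A | s y < s z]| + r y).+1%N = #|A|.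
  move=> yA; rewrite -(cardsID [set z | (s y < s z)%N] A) -addnS; congr (_ + _)%N.
    by apply: eq_card => z; rewrite !inE.
  rewrite (cardsD1 y) !inE ltnn yA /= add1n; congr _.+1.
  apply: eq_card => z; rewrite !inE -leqNgt (ltn_neqAle (s z)) (inj_eq injs).
  by case: (z == y); case: (z \in A); rewrite ?andbT ?andbF.
have rA y : y \in A -> (r y < #|A|)%N by move=> /gtE <-; rewrite ltnS leq_addl.
have r_lt y y' : y \in A -> (s y < s y')%N -> (r y < r y')%N.
  move=> yA yy'; apply: proper_card; rewrite properE; apply/andP; split.
    apply/subsetP => z; rewrite !inE => /andP[-> /=] zy; exact: ltn_trans zy yy'.
  by apply/subsetPn; exists y; rewrite !inE ?yA ?yy' // ltnn.
have r_inj y y' : y \in A -> y' \in A -> r y = r y' -> y = y'.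
  move=> yA y'A e; case: (ltngtP (s y) (s y')) => [/(r_lt _ _ yA)|/(r_lt _ _ y'A)|/injs//].
    by rewrite e ltnn.
  by rewrite e ltnn.
pose f (i : 'I_#|A|) : 'I_#|A| := Ordinal (rA _ (enum_valP i)).
have f_inj : injective f.
  move=> i j /(congr1 val) /= /r_inj e; apply: enum_val_inj; apply: e; exact: enum_valP.
have half : (#|A|./2 < #|A|)%N by have := odd_double_half #|A|; rewrite oddA; lia.
have /codomP[i iE] := injF_onto f_inj (Ordinal half).
exists (enum_val i); first exact: enum_valP.
have rE : r (enum_val i) = #|A|./2 by move/(congr1 val): iE.
move=> y yA; have := gtE y yA; rewrite -/(r y).
have := odd_double_half #|A|; rewrite oddA => h1 h2.
apply/eqP/eqP => [h|->]; last by have := gtE _ (enum_valP i); rewrite rE; lia.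
by apply: r_inj => //; [exact: enum_valP|rewrite rE; lia].
Qed.

Section Perturbation.
Variables (R : realFieldType) (n : nat) (X : finType).
Implicit Types (v mu : X -> 'rV[R]_n.+1) (s : {ffun 'I_n.+1 -> X}).

Lemma generic_exists : exists mu, generic mu.
Proof.
(* Distinct points of the moment curve: the brackets are Vandermonde determinants. *)
exists (fun x => \row_j (enum_rank x)%:R ^+ j) => s injs.
pose a : 'rV[R]_n.+1 := \row_j (enum_rank (s j))%:R.
have -> : bracket (fun x => \row_j (enum_rank x)%:R ^+ j) s = \det (Vandermonde n.+1 a)^T.
  by congr (\det _); apply/matrixP => i j; rewrite !mxE.
rewrite det_tr det_Vandermonde; apply/prodf_neq0 => i _; apply/prodf_neq0 => j ij.
rewrite !mxE subr_eq0 eqr_nat; apply: contraTneq ij => /val_inj/enum_rank_inj/injs ->.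
by rewrite ltnn.
Qed.

Definition perturb v mu (d : R) : X -> 'rV[R]_n.+1 := fun x => v x + d *: mu x.

Definition perturb_poly v mu : X -> 'rV[{poly R}]_n.+1 :=
  fun x => map_mx polyC (v x) + 'X *: map_mx polyC (mu x).

Lemma horner_perturb_poly v mu d x :
  map_mx (horner_eval d) (perturb_poly v mu x) = perturb v mu d x.
Proof. by apply/matrixP => i j; rewrite !mxE /horner_eval !hornerE. Qed.

Lemma horner_bracket v mu d s :
  (bracket (perturb_poly v mu) s).[d] = bracket (perturb v mu d) s.
Proof.
rewrite -[LHS]/(horner_eval d _) -det_map_mx; congr (\det _).
by apply/row_matrixP => i; rewrite -map_row !rowK horner_perturb_poly.
Qed.

(* The leading coefficient in the parameter is the bracket of [mu]. *)
Lemma bracket_perturb_poly_neq0 v mu s : generic mu -> injective s ->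
  bracket (perturb_poly v mu) s != 0.
Proof.
move=> gmu injs; pose A := \matrix_i v (s i); pose B := \matrix_i mu (s i).
have uB : B \in unitmx by rewrite unitmxE unitfE; apply: gmu.
(* [A + 'X B] factors as [B ('X + B^-1 A)], whose determinant is a nonzero scalar times a
   characteristic polynomial. *)
have -> : bracket (perturb_poly v mu) s =
    \det (map_mx polyC B *m char_poly_mx (- (invmx B *m A))).
  congr (\det _); rewrite /char_poly_mx mulmxBr map_mxN map_mxM mulmxN opprK mulmxA.
  rewrite -map_mxM mulmxV // map_mx1 mul1mx mul_mx_scalar addrC.
  by apply/row_matrixP => i; rewrite !rowK linearD linearZ /= -!map_row !rowK.
rewrite det_mulmx det_map_mx mulf_neq0 //; last by rewrite monic_neq0 ?char_poly_monic.
by rewrite /= polyC_eq0; apply: gmu.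
Qed.

Lemma generic_perturb v mu : generic mu ->
  exists2 d, 0 < d & forall t, 0 < t < d -> generic (perturb v mu t).
Proof.
move=> gmu; have [|d d0 hd] := @eventually_all R {ffun 'I_n.+1 -> X}
    (fun s t => injective s -> bracket (perturb v mu t) s != 0).
  move=> s; have [/injectiveP injs|/injectiveP ninj] := boolP (injectiveb s); last by exists 1.
  have [d d0 hd] := poly_neq0_near0 (bracket_perturb_poly_neq0 v gmu injs).
  by exists d => // t /hd; rewrite horner_bracket.
by exists d => // t /hd h s; apply: h.
Qed.

Lemma sgr_bracket_perturb v mu s : bracket v s != 0 ->
  exists2 d, 0 < d & forall t, 0 < t < d ->
    Num.sg (bracket (perturb v mu t) s) = Num.sg (bracket v s).
Proof.
have v0 : bracket (perturb v mu 0) s = bracket v s.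
  by apply: eq_bracket => i; rewrite /perturb scale0r addr0.
case: (ltrgtP (bracket v s) 0) => // h _.
  have [|d d0 hd] := @poly_gt0_near0 _ (- bracket (perturb_poly v mu) s).
    by rewrite hornerN horner_bracket v0 oppr_gt0.
  exists d => // t /hd; rewrite hornerN horner_bracket oppr_gt0 => h'.
  by rewrite !ltr0_sg.
have [|d d0 hd] := @poly_gt0_near0 _ (bracket (perturb_poly v mu) s).
  by rewrite horner_bracket v0.
exists d => // t /hd; rewrite horner_bracket => h'.
by rewrite !gtr0_sg.
Qed.

End Perturbation.

Section Base.
Variables (R : realFieldType) (n : nat) (X : finType) (c : X -> 'I_n).

(* The vectors of one colour lie on a line with direction [e_0]: a choice is
   halving when each of its vectors is the median of its line. *)
Definition base_config (x : X) : 'rV[R]_n.+1 :=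
  row_mx ((enum_rank x)%:R%:M : 'M_1) (delta_mx 0 (c x)).

Lemma bracket_base T z : rainbow c T ->
  bracket base_config (extend_row T z) =
  (enum_rank z)%:R - (enum_rank (T (c z)))%:R.
Proof.
move=> /forallP tT.
pose C : 'cV[R]_n := \col_i (enum_rank (T i))%:R.
have -> : bracket base_config (extend_row T z) =
    \det (block_mx ((enum_rank z)%:R%:M : 'M_1) (delta_mx 0 (c z)) C 1%:M).
  have ordl : (ord0 : 'I_(1 + n)) = lshift n ord0 by apply: val_inj.
  have ordr k : (lift ord0 k : 'I_(1 + n)) = rshift 1 k by apply: val_inj.
  congr (\det _); apply/matrixP => i j; rewrite mxE ffunE /block_mx /base_config.
  case: (unliftP ord0 i) => [k|] -> /=.
    rewrite ordr (@col_mxEd _ 1 n).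
    case: (unliftP ord0 j) => [l|] -> /=; rewrite ?ordr ?ordl.
      by rewrite !(@row_mxEr _ _ 1 n) !mxE (eqP (tT k)) eq_sym.
    by rewrite !(@row_mxEl _ _ 1 n) !mxE mulr1n.
  by rewrite ordl (@col_mxEu _ 1 n).
(* Multiplication by a unipotent block matrix clears the column [C] and leaves a block triangular
   matrix. *)
rewrite -[LHS]mulr1 -[X in _ * X](_ : \det (block_mx (1%:M : 'M_1) 0 (- C) 1%:M) = 1);
  last first.
  by rewrite det_lblock !det1 mulr1.
rewrite -det_mulmx mulmx_block !mulmx1 !mul1mx !mulmx0 addrN !add0r.
rewrite det_ublock det1 mulr1 det_mx11 mxE; congr (_ + _); first by rewrite mxE mulr1n.
rewrite mulmxN -rowE !mxE.
by [].
Qed.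

(** The base configuration need not be generic, so it is perturbed slightly: nonzero signs are kept,
    and the zero signs of chosen vectors are exact. A choice is then halving exactly when it
    consists of the medians, which are unique as the classes are odd. *)
Lemma odd_num_halving_base : (forall i, odd #|[set x | c x == i]|) ->
  exists2 v : X -> 'rV[R]_n.+1, generic v & odd (num_halving c v).
Proof.
move=> oddc.
have [mu gmu] := generic_exists R n X.
have [d d0 hd] := generic_perturb base_config gmu.
have [e e0 he] : exists2 e, 0 < e & forall t, 0 < t < e ->
    forall p : {ffun 'I_n -> X} * X, rainbow c p.1 ->
    Num.sg (bracket (perturb base_config mu t) (extend_row p.1 p.2)) =
    Num.sg ((enum_rank p.2)%:R - (enum_rank (p.1 (c p.2)))%:R : R).
  apply: eventually_all => -[T z] /=.
  have [tT|] := boolP (rainbow c T); last by exists 1.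
  have [Tz|Tz] := eqVneq (T (c z)) z.
    by exists 1 => // t _ _; rewrite -{1}Tz bracket_extend_repeat Tz subrr.
  have [|f f0 hf] := @sgr_bracket_perturb R n X base_config mu (extend_row T z).
    rewrite bracket_base // subr_eq0 eqr_nat; apply: contra_neq Tz.
    by move=> /val_inj/enum_rank_inj.
  by exists f => // t /hf + _; rewrite bracket_base.
pose t := Num.min d e / 2.
have [td te] : 0 < t < d /\ 0 < t < e.
  have m0 : 0 < Num.min d e by rewrite lt_min d0.
  have : t < Num.min d e by rewrite /t; lra.
  have t0 : 0 < t by rewrite /t; lra.
  by rewrite lt_min t0 => /andP[-> ->].
exists (perturb base_config mu t); first exact: hd.
have inj_rank : injective (fun x : X => enum_rank x : nat).
  by move=> x y /val_inj/enum_rank_inj.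
have /fin_all_exists[med hmed] i : exists x, c x = i /\ forall y, c y = i ->
    (\sum_(z | c z == i) Num.sg ((enum_rank z)%:R - (enum_rank y)%:R : R) == 0) = (y == x).
  have [x + hx] := unique_median inj_rank (oddc i); rewrite inE => /eqP cx.
  exists x; split=> // y cy; rewrite -hx ?inE ?cy // sum_sgr subr_eq0 eqr_nat.
  by congr (_ == _); apply: eq_card => z; rewrite !inE ?subr_gt0 ?subr_lt0 ltr_nat.
pose T0 := [ffun i => med i].
have tT0 : rainbow c T0.
  by apply/forallP => i; rewrite ffunE; have [-> _] := hmed i.
rewrite /num_halving (eq_bigr (fun T => (T == T0) : nat)); last first.
  move=> T tT; congr nat_of_bool; have /forallP tT' := tT.
  apply/forallP/eqP => [h|-> i].
    apply/ffunP => i; rewrite ffunE; have [_ hi] := hmed i.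
    apply/eqP; rewrite -hi; last by apply/eqP.
    apply: etrans (h i); congr (_ == _); apply: eq_bigr => z /eqP cz.
    by rewrite (he t te (T, z)) //= cz.
  have [ci hi] := hmed i; have := hi _ ci; rewrite eqxx => /eqP e'.
  apply/eqP; rewrite -[RHS]e'; apply: eq_bigr => z /eqP cz.
  by rewrite (he t te (T0, z)) //= cz ffunE.
rewrite (bigD1 T0) //= eqxx big1 // => T /andP[_ /negbTE ->//].
Qed.

End Base.

(** * The ham sandwich theorem *)

(** [K] is divided by the largest power of ['X] common to its entries. The value of [g] at 0 is then
    a normal vector of the limit hyperplane. *)
Lemma polyvec_factorX (R : fieldType) m (K : 'cV[{poly R}]_m) : K != 0 ->
  exists n (g : 'cV[{poly R}]_m),
    K = 'X^n *: g /\ map_mx (horner_eval 0) g != 0.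
Proof.
move=> /matrix0Pn[i [j]]; rewrite (ord1 j) => {j}.
move: {2}(size _) (leqnn (size (K i 0))) => k.
elim: k K => [|k IH] K; first by rewrite leqn0 size_poly_eq0 => ->.
move=> sk Ki.
have [K0|] := eqVneq (map_mx (horner_eval 0) K) 0; last first.
  by exists 0%N, K; split; rewrite ?expr0 ?scale1r.
have dvdX j : K j 0 = 'X * (K j 0 %/ 'X).
  have : root (K j 0) 0 by move/matrixP/(_ j 0): K0; rewrite !mxE => /eqP.
  by rewrite -dvdp_XsubCl polyC0 subr0 => /divpK e; rewrite -{1}e mulrC.
have Ki' : K i 0 %/ 'X != 0.
  by apply: contraNneq Ki => e; rewrite dvdX e mulr0.
have [|//|n [g [gE g0]]] := IH (\col_j (K j 0 %/ 'X)); rewrite ?mxE //.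
  by move: sk; rewrite {1}dvdX mulrC size_mulX.
exists n.+1, g; split=> //; apply/matrixP => a b.
move/matrixP/(_ a 0): gE; rewrite (ord1 b) dvdX !mxE => ->.
by rewrite exprS mulrA.
Qed.

Section HamSandwich.
Variables (R : realFieldType) (n : nat).

(** Signs of polynomials are constant near 0, so one choice [T] halves all small perturbations of
    [w]. In the limit vectors may fall on the hyperplane but cannot cross it, which turns equalities
    into inequalities. *)
Lemma ham_sandwich_odd (X : finType) (c : X -> 'I_n) (w : X -> 'rV[R]_n.+1) :
  (forall i, odd #|[set x | c x == i]|) ->
  exists2 f : 'cV[R]_n.+1, f != 0 & forall i,
    ((#|[set x | c x == i & (0 < (w x *m f) 0 0)%R]|).*2 <= #|[set x | c x == i]|)%N /\
    ((#|[set x | c x == i & ((w x *m f) 0 0 < 0)%R]|).*2 <= #|[set x | c x == i]|)%N.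
Proof.
move=> oddc.
have [mu gmu] := generic_exists R n X.
have [b0 gb0 odd0] := odd_num_halving_base R oddc.
have [d d0 hd] := generic_perturb w gmu.
pose P (T : {ffun 'I_n -> X}) z := bracket (perturb_poly w mu) (extend_row T z).
have [e e0 he] : exists2 e, 0 < e & forall t, 0 < t < e ->
    forall p : {ffun 'I_n -> X} * X, forall r, 0 < r < e -> Num.sg (P p.1 p.2).[t] = Num.sg (P p.1 p.2).[r].
  pose Q (p : {ffun 'I_n -> X} * X) (e : R) :=
    0 < e /\ forall t r, 0 < t <= e -> 0 < r <= e ->
    Num.sg (P p.1 p.2).[t] = Num.sg (P p.1 p.2).[r].
  have [e e0 he] : exists2 e, 0 < e & forall t, 0 < t < e -> forall p, Q p t.
    apply: eventually_all => p; have [e e0 he] := poly_sg_near0 (P p.1 p.2).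
    exists e => // t /andP[t0 te]; split=> // a b /andP[a0 at_] /andP[b0' bt].
    by apply: he; rewrite ?a0 ?b0' /= (le_lt_trans _ te).
  have e2 : 0 < e / 2 < e by lra.
  exists (e / 2) => [|t /andP[t0 te] p r /andP[r0 re]]; first by lra.
  by have [_ h] := he _ e2 p; apply: h; rewrite ?t0 ?r0 ltW.
pose t1 := Num.min d e / 2.
have [t1d t1e] : 0 < t1 < d /\ 0 < t1 < e.
  have m0 : 0 < Num.min d e by rewrite lt_min d0.
  have : t1 < Num.min d e by rewrite /t1; lra.
  have t0 : 0 < t1 by rewrite /t1; lra.
  by rewrite lt_min t0 => /andP[-> ->].
have [T /andP[tT hT]] : exists T, rainbow c T && halving c (perturb w mu t1) T.
  have := odd_num_halving_generic c (hd _ t1d) gb0; rewrite odd0.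
  case: (pickP (fun T => rainbow c T && halving c (perturb w mu t1) T)) => [T hT _|h].
    by exists T.
  rewrite /num_halving big1 // => T tT.
  by have := h T; rewrite tT /= => ->.
(* If every vector is chosen, they span at most [n] dimensions and some [f != 0] vanishes on all of
   them. *)
have [/existsP[z zT]|] := boolP [exists z, z \notin codom T]; last first.
  rewrite negb_exists => /forallP allT.
  pose W := \matrix_i w (T i).
  have ker0 : kermx W^T != 0.
    by rewrite -mxrank_eq0 mxrank_ker -lt0n subn_gt0 ltnS mxrank_tr rank_leq_row.
  have [f f0 Wf] : exists2 f : 'cV_n.+1, f != 0 & W *m f = 0.
    exists (nz_row (kermx W^T))^T; first by rewrite trmx_eq0 nz_row_eq0.
    by apply: trmx_inj; rewrite trmx_mul trmxK trmx0; apply/sub_kermxP/nz_row_sub.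
  have w0 x : (w x *m f) 0 0 = 0.
    have := allT x; rewrite negbK => /codomP[i ->].
    by move/matrixP/(_ i 0): Wf; rewrite !mxE => Wfi;
      rewrite -[RHS]Wfi; apply: eq_bigr => j _; rewrite !mxE.
  by exists f => // i; split; rewrite eq_card0 // => x; rewrite !inE w0 ltxx andbF.
pose K := cofactors (\matrix_i perturb_poly w mu (T i)).
have PE x : P T x = (perturb_poly w mu x *m K) 0 0 by rewrite /P bracket_extend.
have K0 : K != 0.
  have nz : bracket (perturb w mu t1) (extend_row T z) != 0.
    apply: hd => //; apply: (extend_row_inj tT).
    by apply: contraNneq zT => <-; apply: codom_f.
  apply: contraNneq nz => K0; rewrite -horner_bracket -/(P T z) PE K0 mulmx0 mxE.
  by rewrite horner0.
have [k [g [gE g0]]] := polyvec_factorX K0.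
pose f := map_mx (horner_eval 0) g.
pose G x := (perturb_poly w mu x *m g) 0 0.
have PG x : P T x = 'X^k * G x by rewrite PE gE -scalemxAr mxE.
have w0 x : perturb w mu 0 x = w x by rewrite /perturb scale0r addr0.
have G0 x : (G x).[0] = (w x *m f) 0 0.
  by rewrite -w0 -horner_perturb_poly /f -map_mxM [RHS]mxE.
have [r r0 hr] : exists2 r, 0 < r & forall t, 0 < t < r -> forall x,
   (0 < (w x *m f) 0 0 -> 0 < (G x).[t]) /\ ((w x *m f) 0 0 < 0 -> (G x).[t] < 0).
  apply: eventually_all => x; rewrite -G0.
  case: (ltrgtP (G x).[0] 0) => h; last by exists 1.
    have [|r r0 hr] := @poly_gt0_near0 _ (- G x); first by rewrite hornerN oppr_gt0.
    by exists r => // t /hr; rewrite hornerN oppr_gt0.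
  by have [r r0 hr] := poly_gt0_near0 h; exists r => // t /hr.
(* At [t2] the signs of [P T] are still those at [t1], where [T] is halving, and those of [G] agree
   with the limit wherever the limit is nonzero. *)
pose t2 := Num.min r e / 2.
have [t2r t2e] : 0 < t2 < r /\ 0 < t2 < e.
  have m0 : 0 < Num.min r e by rewrite lt_min r0.
  have : t2 < Num.min r e by rewrite /t2; lra.
  have t0 : 0 < t2 by rewrite /t2; lra.
  by rewrite lt_min t0 => /andP[-> ->].
have /andP[t2_gt0 _] := t2r.
exists f => // i; have /eqP := forallP hT i.
rewrite (eq_bigr (fun x => Num.sg (G x).[t2])); last first.
  move=> x _; rewrite -horner_bracket -/(P T x) (he t1 t1e (T, x) t2 t2e) /= PG.
  by rewrite hornerM sgrM hornerXn (gtr0_sg (exprn_gt0 _ t2_gt0)) mul1r.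
rewrite sum_sgr => /eqP; rewrite subr_eq0 eqr_nat => /eqP pn.
have tot : (#|[set x | c x == i & (0 < (G x).[t2])%R]| + #|[set x | c x == i & ((G x).[t2] < 0)%R]| <=
    #|[set x | c x == i]|)%N.
  rewrite -cardsUI [X in (_ + X)%N](_ : _ = 0%N) ?addn0.
    by apply: subset_leq_card; apply/subsetP => x; rewrite !inE => /orP[]/andP[].
  apply: eq_card0 => x; rewrite !inE; case: (c x == i) => //=.
  by case: ltrgtP.
split; [have le : (#|[set x | c x == i & (0 < (w x *m f) 0 0)%R]| <=
    #|[set x | c x == i & (0 < (G x).[t2])%R]|)%N |
  have le : (#|[set x | c x == i & ((w x *m f) 0 0 < 0)%R]| <=
    #|[set x | c x == i & ((G x).[t2] < 0)%R]|)%N].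
- by apply: subset_leq_card; apply/subsetP => x; rewrite !inE => /andP[->]; have [h _] := hr _ t2r x.
- by rewrite -addnn; apply: leq_trans tot; rewrite -pn leq_add.
- by apply: subset_leq_card; apply/subsetP => x; rewrite !inE => /andP[->]; have [_ h] := hr _ t2r x.
- by rewrite -addnn; apply: leq_trans tot; rewrite pn leq_add.
Qed.

(* A dummy vector is added to each class of even size. *)
Theorem ham_sandwich (X : finType) (c : X -> 'I_n) (w : X -> 'rV[R]_n.+1) :
  exists2 f : 'cV[R]_n.+1, f != 0 & forall i,
    ((#|[set x | c x == i & (0 < (w x *m f) 0 0)%R]|).*2 <= #|[set x | c x == i]|)%N /\
    ((#|[set x | c x == i & ((w x *m f) 0 0 < 0)%R]|).*2 <= #|[set x | c x == i]|)%N.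
Proof.
pose even_class (i : 'I_n) := ~~ odd #|[set x | c x == i]|.
pose Y := (X + {i : 'I_n | even_class i})%type.
pose c' (y : Y) := match y with inl x => c x | inr i => val i end.
pose w' (y : Y) := match y with inl x => w x | inr i => 0 end.
have cardY i : #|[set y | c' y == i]| = (#|[set x | c x == i]| + even_class i)%N.
  rewrite -!sum1dep_card !big_mkcond big_sumType /=; congr (_ + _)%N.
    by rewrite -big_mkcond.
  have [ei|oi] := boolP (even_class i).
    rewrite (bigD1 (exist _ i ei)) //= eqxx big1 // => j ji.
    by case: eqP => // e; case/eqP: ji; apply: val_inj.
  by rewrite big1 // => -[j ej] _ /=; case: eqP => // e; rewrite -e ej in oi.
have oddY i : odd #|[set y | c' y == i]|.
  by rewrite cardY oddD /even_class; case: (odd _).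
have [f f0 hf] := ham_sandwich_odd w' oddY.
exists f => // i; have [] := hf i; rewrite cardY.
have leY (Q : pred X) (Q' : pred Y) : (forall x, Q' (inl x) = Q x) ->
  (#|[set x | c x == i & Q x]| <= #|[set y | c' y == i & Q' y]|)%N.
  move=> QQ; rewrite -(card_imset _ (@inl_inj X {i : 'I_n | even_class i})).
  by apply: subset_leq_card; apply/subsetP => _ /imsetP[x + ->]; rewrite !inE /= QQ.
have := leY (fun x => 0 < (w x *m f) 0 0) (fun y => 0 < (w' y *m f) 0 0) (fun=> erefl).
have := leY (fun x => (w x *m f) 0 0 < 0) (fun y => (w' y *m f) 0 0 < 0) (fun=> erefl).
rewrite /even_class; set a := #|_|; set b := #|_|;
  set p := #|_|; set q := #|_|; set m := #|_|.
(* For even [m] the dummy vector only gives the bound [m + 1], which parity improves to [m]. *)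
have := odd_double_half m; rewrite -!muln2; case: (odd m) => /=; lia.
Qed.

End HamSandwich.

(** * Polynomial partitioning *)

Definition eval_at (R : comNzRingType) n (x : 'rV[R]_n) (p : mpoly n R) : R :=
  meval (fun i => x ord0 i) p.

(** The ham sandwich theorem applied after the Veronese map, whose coordinates are the [K ^ m]
    monomials with all exponents below [K]. *)
Lemma poly_bisection (R : realFieldType) m (X C : finType) (pt : X -> 'rV[R]_m)
    (c : X -> C) (K : nat) :
  (#|C| < K ^ m)%N ->
  exists p : mpoly m R, [/\ p != 0, (msize p <= (m * K.-1).+1)%N & forall i,
    ((#|[set x | c x == i & (0 < eval_at (pt x) p)%R]|).*2 <= #|[set x | c x == i]|)%N /\
    ((#|[set x | c x == i & (eval_at (pt x) p < 0)%R]|).*2 <= #|[set x | c x == i]|)%N].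
Proof.
move=> hC; pose n := (K ^ m).-1.
have nE : n.+1 = #|{ffun 'I_m -> 'I_K}|.
  by rewrite card_ffun !card_ord prednK // (leq_ltn_trans _ hC).
have Cn : (#|C| <= n)%N by rewrite -ltnS prednK // (leq_ltn_trans _ hC).
pose mon (j : 'I_n.+1) : multinom m :=
  Multinom [tuple (enum_val (cast_ord nE j) i : nat) | i < m].
have monE j i : mon j i = enum_val (cast_ord nE j) i by rewrite multinomE tnth_mktuple.
have mon_inj : injective mon.
  move=> j k e; apply: (@cast_ord_inj _ _ nE); apply: enum_val_inj.
  apply/ffunP => i; apply: val_inj; rewrite /= -!monE; by rewrite e.
pose c' x : 'I_n := widen_ord Cn (enum_rank (c x)).
pose w x : 'rV[R]_n.+1 := \row_j eval_at (pt x) (mpolyX R (mon j)).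
have [f f0 hf] := ham_sandwich c' w.
pose p : mpoly m R := \sum_j f j 0 *: mpolyX R (mon j).
have pE x : eval_at (pt x) p = (w x *m f) 0 0.
  rewrite /eval_at raddf_sum mxE; apply: eq_bigr => j _ /=.
  by rewrite mevalZ mxE mulrC.
exists p; split.
- have /matrix0Pn[j [z]] := f0; rewrite (ord1 z) => fj.
  apply: contraNneq fj => p0; have : mcoeff (mon j) p = 0 by rewrite p0 mcoeff0.
  rewrite raddf_sum (bigD1 j) //= big1 ?addr0 => [|k kj].
    by rewrite mcoeffZ mcoeffX eqxx mulr1 => ->.
  by rewrite mcoeffZ mcoeffX (inj_eq mon_inj) (negbTE kj) mulr0.
- apply: (leq_trans (mmeasure_sum _ _ _ _)); apply/bigmax_leqP => j _.
  apply: (leq_trans (mmeasureZ_le _ _ _)); rewrite mmeasureX ltnS [X in (X <= _)%N]mdegE.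
  rewrite -[m in (m * _)%N]card_ord -sum_nat_const; apply: leq_sum => i _.
  rewrite monE; case: (enum_val (cast_ord nE j) i) => k kK /=.
  by rewrite -ltnS prednK // (leq_ltn_trans _ kK).
- move=> i; have [h1 h2] := hf (widen_ord Cn (enum_rank i)).
  have cE x : (c' x == widen_ord Cn (enum_rank i)) = (c x == i).
    by rewrite -val_eqE /= val_eqE (inj_eq enum_rank_inj).
  have setE (Q Q' : pred X) : Q =1 Q' ->
      [set x | c' x == widen_ord Cn (enum_rank i) & Q x] = [set x | c x == i & Q' x].
    by move=> QQ; apply/setP => x; rewrite !inE cE QQ.
  have classE : [set x | c' x == widen_ord Cn (enum_rank i)] = [set x | c x == i].
    by apply/setP => x; rewrite !inE cE.
  rewrite -(setE (fun x => 0 < (w x *m f) 0 0)) => [|x]; last by rewrite pE.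
  rewrite -(setE (fun x => (w x *m f) 0 0 < 0)) => [|x]; last by rewrite pE.
  by rewrite -classE.
Qed.

Section Partition.
Variables (R : realFieldType) (m : nat).
Implicit Types (ps : seq (mpoly m R)) (x : 'rV[R]_m).

Definition off_zeros ps x := all (fun p => eval_at x p != 0) ps.

Definition sign_pattern ps x : seq bool := map (fun p => 0 < eval_at x p) ps.

Definition total_degree ps := (\sum_(p <- ps) (msize p).-1)%N.

Definition partitions (X : finType) (pt : X -> 'rV[R]_m) ps := forall b : seq bool,
  (#|[set x | off_zeros ps (pt x) & sign_pattern ps (pt x) == b]| * 2 ^ size ps <= #|X|)%N.

(** One polynomial bisects all cells at once. The points on the zero sets form the additional class
    [None], hence the [+ 1]. *)
Lemma partition_refine (X : finType) (pt : X -> 'rV[R]_m) ps K :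
  partitions pt ps -> (2 ^ size ps + 1 < K ^ m)%N ->
  exists p, [/\ p != 0, (msize p <= (m * K.-1).+1)%N & partitions pt (p :: ps)].
Proof.
move=> part hK.
pose c (x : X) : option ((size ps).-tuple bool) :=
  if off_zeros ps (pt x) then insub (sign_pattern ps (pt x)) else None.
have [|p [p0 sp hp]] := @poly_bisection R m X _ pt c K.
  by rewrite card_option card_tuple card_bool -addn1.
exists p; split=> // b.
set A := [set x | _ & _]; have [->|[x0 x0A]] := set_0Vmem A; first by rewrite cards0.
have cE (x : X) : off_zeros ps (pt x) ->
    exists2 t, c x = Some t & val t = sign_pattern ps (pt x).
  move=> ox; rewrite /c ox; case: insubP => [t _ <-|]; first by exists t.
  by rewrite size_map eqxx.
have [x0n b0] : off_zeros (p :: ps) (pt x0) /\ sign_pattern (p :: ps) (pt x0) = b.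
  by move: x0A; rewrite inE => /andP[? /eqP].
move: x0n => /= /andP[p0x off0]; have [t ct te] := cE _ off0.
have classE : (#|[set x | c x == c x0]| * 2 ^ size ps <= #|X|)%N.
  apply: leq_trans (part t); rewrite leq_mul2r; apply/orP; right.
  apply: subset_leq_card; apply/subsetP => x; rewrite !inE ct /c.
  case: ifP => //= ox; case: insubP => [u _ <-|]; last by rewrite size_map eqxx.
  by move/eqP=> [->].
have AE (x : X) : x \in A -> c x = c x0 /\ eval_at (pt x) p != 0 /\
    (0 < eval_at (pt x) p) = (0 < eval_at (pt x0) p).
  rewrite inE -b0 => /andP[/= /andP[px ox] /eqP[-> e]]; split=> //.
  by rewrite /c ox off0 e.
apply: leq_trans classE; rewrite /= expnS mulnA leq_mul2r; apply/orP; right.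
rewrite muln2; have [h1 h2] := hp (c x0).
have [pos|neg] := boolP (0 < eval_at (pt x0) p).
  apply: leq_trans h1; rewrite leq_double; apply: subset_leq_card.
  by apply/subsetP => x /AE[cx [_ e]]; rewrite inE cx eqxx e.
apply: leq_trans h2; rewrite leq_double; apply: subset_leq_card.
apply/subsetP => x /AE[cx [nz e]]; rewrite inE cx eqxx /=.
by rewrite lt_neqAle nz leNgt e.
Qed.

End Partition.

Theorem polynomial_partition (R : realFieldType) (X : finType)
    (pt : X -> 'rV[R]_3) (I : nat) :
  exists ps : seq (mpoly 3 R), [/\ size ps = (3 * I)%N, all (fun p => p != 0) ps,
    (total_degree ps <= 18 * 2 ^ I)%N & partitions pt ps].
Proof.
elim: I => [|I [ps [sz nz deg part]]].
  exists [::]; split; rewrite ?/total_degree ?big_nil //.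
  by move=> b; rewrite expn0 muln1 max_card.
(* Three bisections multiply the number of cells by 8. The last one has at most
   [4 * 2 ^ (3 * I) + 1] classes, fewer than [K ^ 3], and each adds degree at most
   [3 * K = 6 * 2 ^ I]: in total [18 * 2 ^ I], as much as the bound grows. *)
pose K := (2 ^ I.+1)%N.
have K3 : (K ^ 3 = 8 * 2 ^ (3 * I))%N.
  by rewrite /K -expnM (_ : I.+1 * 3 = 3 + 3 * I)%N ?expnD //; lia.
have pos : (0 < 2 ^ (3 * I))%N by rewrite expn_gt0.
have KE : (3 * K = 6 * 2 ^ I)%N by rewrite /K expnS; lia.
have [|p1 [nz1 d1 part1]] := partition_refine (K := K) part.
  by rewrite K3 sz; lia.
have [|p2 [nz2 d2 part2]] := partition_refine (K := K) part1.
  by rewrite K3 /= sz expnS; lia.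
have [|p3 [nz3 d3 part3]] := partition_refine (K := K) part2.
  by rewrite K3 /= sz !expnS; lia.
exists [:: p3, p2, p1 & ps]; split => //.
- by rewrite /= sz; lia.
- by rewrite /= nz1 nz2 nz3.
- rewrite /total_degree !big_cons -/(total_degree ps) expnS; lia.
Qed.

(** * Restriction to a line *)

Lemma poly_roots_seq (R : fieldType) (p : {poly R}) : p != 0 ->
  exists2 rs : seq R, (size rs < size p)%N & forall x, root p x -> x \in rs.
Proof.
move: {2}(size p) (leqnn (size p)) => k.
elim: k p => [|k IH] p; first by rewrite leqn0 size_poly_eq0 => ->.
move=> sp p0; have [[x px]|nr] := EM (exists x, root p x); last first.
  by exists [::]; [rewrite size_poly_gt0|move=> x px; case: nr; exists x].
have [q pE] := factor_theorem p x px.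
have q0 : q != 0 by apply: contraNneq p0 => q0; rewrite pE q0 mul0r.
have sE : size p = (size q).+1.
  by rewrite pE size_mul ?polyXsubC_eq0 // size_XsubC addn2.
have [|rs srs hrs] := IH q _ q0; first by rewrite sE ltnS in sp.
exists (x :: rs); first by rewrite sE ltnS.
move=> y; rewrite pE rootM root_XsubC inE orbC => /orP[->//|/hrs ->].
by rewrite orbT.
Qed.

Lemma count_eq_sub (T : eqType) (a1 a2 : pred T) (s : seq T) :
  subpred a1 a2 -> count a1 s = count a2 s -> forall x, x \in s -> a2 x -> a1 x.
Proof.
move=> a12; elim: s => //= y s IH e x.
have le := sub_count a12 s.
have [e1 e2] : a1 y = a2 y /\ count a1 s = count a2 s.
  move: e le; have := a12 y; case: (a1 y); case: (a2 y) => //=; first by move=> _ [].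
    by move=> /(_ isT).
  by move=> _; rewrite add0n add1n => ->; rewrite ltnn.
by rewrite inE => /predU1P[->|]; [rewrite e1|apply: IH].
Qed.

Section Restriction.
Variables (R : comNzRingType) (n : nat).
Implicit Types (a v : 'rV[R]_n) (p : mpoly n R).

Definition restrict_line a v p : {poly R} :=
  mmap polyC (fun i => (a 0 i)%:P + v 0 i *: 'X) p.

Lemma horner_restrict_line a v p t :
  (restrict_line a v p).[t] = eval_at (a + t *: v) p.
Proof.
rewrite /restrict_line /mmap horner_sum /eval_at mevalE; apply: eq_bigr => m _.
rewrite hornerM hornerC /mmap1 horner_prod; congr (_ * _); apply: eq_bigr => i _.
by rewrite horner_exp !hornerE !mxE mulrC.
Qed.

End Restriction.

Lemma size_restrict_line (R : idomainType) n (a v : 'rV[R]_n) (p : mpoly n R) :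
  (size (restrict_line a v p) <= msize p)%N.
Proof.
rewrite /restrict_line /mmap; apply: (leq_trans (size_sum _ _ _)).
apply/bigmax_leqP_seq => m mp _; apply: leq_trans (mmeasure_mnm_lt _ mp).
rewrite mul_polyC (leq_trans (size_scale_leq _ _)) // /mmap1 [X in (_ <= X.+1)%N]mdegE.
apply: (leq_trans (size_prod_leq _ _)); rewrite card_ord.
have le : (\sum_(i < n) size (((a ord0 i)%:P + v ord0 i *: 'X) ^+ m i)%R <=
    \sum_(i < n) (m i).+1)%N.
  apply: leq_sum => i _; apply: (leq_trans (size_poly_exp_leq _ _)); rewrite ltnS.
  rewrite -[X in (_ <= X)%N]mul1n leq_mul2r; apply/orP; right.
  rewrite -subn1 leq_subLR (leq_trans (size_polyD _ _)) // geq_max.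
  rewrite (leq_trans (size_polyC_leq1 _)) //= (leq_trans (size_scale_leq _ _)) //.
  by rewrite size_polyX.
rewrite leq_subLR; apply: (leq_ltn_trans le).
by rewrite (eq_bigr (fun i => m i + 1)%N) => [|i _]; rewrite ?addn1 //
  big_split /= sum1_card card_ord addnS ltnS addnC.
Qed.

Section LinePartition.
Variables (R : rcfType) (n : nat) (X : finType) (pt : X -> 'rV[R]_n).
Variables (a v : 'rV[R]_n) (ps : seq (mpoly n R)) (D : {set X}) (param : X -> R).
Hypothesis ptE : forall x, x \in D -> pt x = a + param x *: v.
Hypothesis restrict_neq0 : all (fun p => restrict_line a v p != 0) ps.

Lemma line_roots : exists2 rs : seq R, (size rs <= total_degree ps)%N &
  forall p, p \in ps -> forall t, root (restrict_line a v p) t -> t \in rs.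
Proof.
elim: ps restrict_neq0 => [|p qs IH] /=;
  first by exists [::]; rewrite // /total_degree big_nil.
move=> /andP[p0 /IH[rs srs hrs]]; have [rs' srs' hrs'] := poly_roots_seq p0.
exists (rs' ++ rs).
  rewrite size_cat /total_degree big_cons leq_add //.
  by have := size_restrict_line a v p; case: (msize p) => [|k] h; move: (leq_trans srs' h).
move=> q; rewrite inE => /predU1P[->|qqs] t qt; rewrite mem_cat.
  by rewrite hrs'.
by rewrite (hrs _ qqs) ?orbT.
Qed.

Lemma line_zeros : injective pt ->
  (#|[set x in D | ~~ off_zeros ps (pt x)]| <= total_degree ps)%N.
Proof.
move=> injpt; have [rs srs hrs] := line_roots.
apply: leq_trans srs; rewrite cardE -(size_map param).
apply: uniq_leq_size.
  rewrite map_inj_in_uniq ?enum_uniq // => x y; rewrite !mem_enum !inE.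
  by move=> /andP[xD _] /andP[yD _] e; apply: injpt; rewrite !ptE // e.
move=> t /mapP[x]; rewrite mem_enum inE => /andP[xD /allPn[p pps]].
rewrite negbK => px ->; apply: hrs pps _ _.
by rewrite rootE horner_restrict_line -ptE.
Qed.

(** By the intermediate value theorem, the number [rk] of roots below a point of the line determines
    its sign pattern, and [rk] takes at most one value more than there are roots. *)
Lemma line_cells :
  (#|[set b : (size ps).-tuple bool |
      [exists x in D, off_zeros ps (pt x) && (sign_pattern ps (pt x) == b)]]|
   <= (total_degree ps).+1)%N.
Proof.
have [rs srs hrs] := line_roots.
pose rk x := count (fun r => r < param x) rs.
have rkP x : (rk x < (size rs).+1)%N by rewrite ltnS count_size.
have same x y : x \in D -> y \in D -> off_zeros ps (pt x) -> off_zeros ps (pt y) ->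
    rk x = rk y -> sign_pattern ps (pt x) = sign_pattern ps (pt y).
  wlog le : x y / param x <= param y.
    move=> h; case: (leP (param x) (param y)) => [/h//|/ltW /h{}h] *.
    by apply/esym/h.
  move=> xD yD /allP ox /allP oy e; apply/eq_in_map => p pps.
  have px := ox p pps; have py := oy p pps.
  have lt_sub : subpred (fun r => r < param x) (fun r => r < param y).
    by move=> r /= h; apply: lt_le_trans h le.
  have noroot r : root (restrict_line a v p) r -> param x <= r <= param y -> False.
    move=> pr /andP[xr ry].
    have ry' : r < param y.
      rewrite lt_neqAle ry andbT; apply: contraNneq py => re.
      by rewrite ptE // -horner_restrict_line -re -rootE.
    by have := count_eq_sub lt_sub e (hrs p pps r pr) ry'; rewrite ltNge xr.
  apply/idP/idP => h; apply/negPn/negP; rewrite -leNgt => h'.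
    have [|r rxy pr] := @poly_ivt _ (- restrict_line a v p) _ _ le.
      by rewrite !hornerN !horner_restrict_line -!ptE // oppr_le0 oppr_ge0 h' ltW.
    by apply: (noroot r) => //; rewrite rootN in pr.
  have [|r rxy pr] := @poly_ivt _ (restrict_line a v p) _ _ le.
    by rewrite !horner_restrict_line -!ptE // h' ltW.
  exact: (noroot r).
(* The pattern of any point of rank [k]; the constant [false] pattern only stands in for ranks that
   no point has. *)
pose g (k : 'I_(size rs).+1) : (size ps).-tuple bool :=
  odflt [tuple of nseq _ false]
   (obind insub (omap (sign_pattern ps \o pt)
     [pick x in D | off_zeros ps (pt x) && (rk x == k)])).
have sub : [set b : (size ps).-tuple bool |
      [exists x in D, off_zeros ps (pt x) && (sign_pattern ps (pt x) == b)]] \subset g @: setT.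
  apply/fintype.subsetP => b; rewrite inE => /exists_inP[x xD /andP[ox /eqP xb]].
  apply/imsetP; exists (Ordinal (rkP x)) => //; rewrite /g.
  case: fintype.pickP => [y /and3P[yD oy /eqP yx]|/(_ x)]; last by rewrite xD ox eqxx.
  by rewrite /= (same y x) // xb valK.
apply: leq_trans (subset_leq_card sub) _; apply: leq_trans (leq_imset_card _ _) _.
by rewrite cardsT card_ord ltnS.
Qed.

End LinePartition.

(** * Induction on the number of lines *)

(* Imported only here since names such as [filter] and [subsetP] get shadowed. *)
From mathcomp Require Import all_classical all_reals all_analysis.

Section Induction.
Variables (T X B : finType) (inc : X -> T -> bool) (S D : nat).

Definition rich (A : {set T}) (x : X) :=
  [exists l in A, exists l' in A, [&& l != l', inc x l & inc x l']].

Definition cell_lines (Z : {set X}) (k : X -> B) (A : {set T}) (b : B) :=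
  [set l in A | [exists x, [&& x \notin Z, inc x l & k x == b]]].

Hypothesis lines_meet_once : forall l l' x x', l != l' ->
  inc x l -> inc x l' -> inc x' l -> inc x' l' -> x = x'.

(** A rich point is charged to a line of [A] through it outside [con] if there is one, and otherwise
    to a pair of distinct lines of [con], which meet only once. *)
Lemma rich_on_zeros (A con : {set T}) (Y Z : {set X}) :
  (forall x, x \in Y -> rich A x) -> (#|con| <= S)%N ->
  (forall l, l \notin con -> (#|[set x in Z | inc x l]| <= D)%N) ->
  (#|Y :&: Z| <= #|A| * D + S * S)%N.
Proof.
move=> YA conS lD.
pose f x l : nat := (l \notin con) && (x \in Z) && inc x l.
pose g x (p : T * T) : nat := (p.1 != p.2) && inc x p.1 && inc x p.2.
have le x : x \in Y :&: Z ->
    (1 <= \sum_(l in A) f x l + \sum_(p in finset.setX con con) g x p)%N.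
  rewrite inE => /andP[/YA/exists_inP[l lA /exists_inP[l' l'A /and3P[ll' xl xl']]] xZ].
  have [lc|lc] := boolP (l \in con); last by rewrite (bigD1 l) //= /f lc xZ xl.
  have [lc'|lc'] := boolP (l' \in con); last by rewrite (bigD1 l') //= /f lc' xZ xl'.
  by rewrite addnC (bigD1 (l, l')) ?inE ?lc //= /g /= ll' xl xl'.
rewrite -[X in (X <= _)%N]sum1_card.
apply: (@leq_trans (\sum_(x in Y :&: Z)
  (\sum_(l in A) f x l + \sum_(p in finset.setX con con) g x p)));
  first exact: leq_sum.
rewrite big_split /=; apply: leq_add.
  rewrite exchange_big /= -sum_nat_const; apply: leq_sum => l _.
  have [lc|lc] := boolP (l \in con); first by rewrite big1 // => x _; rewrite /f lc.
  apply: leq_trans (lD l lc); rewrite -sum1dep_card big_mkcond [X in (_ <= X)%N]big_mkcond /=.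
  by apply: leq_sum => x _; rewrite /f lc /=; case: (_ \in _ :&: _); case: (_ && _).
apply: (@leq_trans (\sum_(p in finset.setX con con) 1)); last first.
  by rewrite sum1_card cardsX leq_mul.
rewrite exchange_big /=; apply: leq_sum => -[l l'] _.
have [/existsP[x /andP[xYZ gx]]|] :=
  boolP [exists x, (x \in Y :&: Z) && (g x (l, l') == 1)%N].
  rewrite (bigD1 x) //= big1 => [|x' /andP[_ x'x]]; first by rewrite addn0 /g leq_b1.
  apply/eqP; rewrite eqb0; apply: contraNN x'x => /andP[/andP[ll' h1] h2].
  move: gx; rewrite eqb1 => /andP[/andP[_ h3] h4].
  by apply/eqP; apply: (lines_meet_once ll').
rewrite negb_exists => /forallP h; rewrite big1 // => x xYZ; apply/eqP.
by have := h x; rewrite xYZ /= eqb1 eqb0.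
Qed.

Lemma sum_cell_lines (Z : {set X}) (k : X -> B) (A : {set T}) :
  (forall l, (#|[set b | [exists x, [&& x \notin Z, inc x l & k x == b]]]| <= D.+1)%N) ->
  (\sum_b #|cell_lines Z k A b| <= #|A| * D.+1)%N.
Proof.
move=> h; rewrite -sum_nat_const.
under eq_bigr => b _ do rewrite -sum1dep_card big_mkcondr.
rewrite exchange_big /=; apply: leq_sum => l _; apply: leq_trans (h l).
by rewrite -big_mkcond sum1dep_card.
Qed.

Variables (R : realType) (a : R).
Let M := #|B|.
Let r : R := 2 * D.+1%:R / M%:R.
Hypotheses (a1 : 1 <= a) (M0 : (0 < M)%N) (r1 : r < 1) (Mr : M%:R * r `^ a <= 1 / 4).

Hypothesis partition : forall Y : {set X}, exists (Z : {set X}) (con : {set T}) (k : X -> B),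
  [/\ (#|con| <= S)%N,
      forall b, (#|[set x in Y :\: Z | k x == b]| * M <= #|Y|)%N,
      forall l, l \notin con -> (#|[set x in Z | inc x l]| <= D)%N &
      forall l, (#|[set b | [exists x, [&& x \notin Z, inc x l & k x == b]]]| <= D.+1)%N].

Let C : R := 4 * (D + S * S)%:R.

(* A cell with more than [r * #|A|] lines is charged for its share [#|Y| / M] of
   the points, and there are at most [M / 2] such cells; the others are handled
   by induction. *)
Lemma rich_bound (A : {set T}) (Y : {set X}) :
  (forall x, x \in Y -> rich A x) -> #|Y|%:R <= C * #|A|%:R `^ a.
Proof.
move: {2}#|A|.+1 (ltnSn #|A|) => m.
elim: m A Y => // m IH A Y; rewrite ltnS => Am YA.
have C0 : 0 <= C by rewrite /C mulr_ge0.
have M_gt0 : 0 < M%:R :> R by rewrite ltr0n.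
have [A0|A0] := posnP #|A|.
  rewrite (_ : #|Y| = 0)%N ?mulr_ge0 ?powR_ge0 //.
  apply: eq_card0 => x; apply/negP => /YA/exists_inP[l lA _].
  by move: A0; rewrite (cardsD1 l) lA.
have nA0 : 0 < #|A|%:R :> R by rewrite ltr0n.
have [Z [con [k [conS cell lD lcell]]]] := partition Y.
set n : R := #|A|%:R in nA0 *; set q : R := #|Y|%:R.
have q0 : 0 <= q by rewrite /q.
have on_zeros : (#|Y :&: Z|%:R : R) <= (D + S * S)%:R * n `^ a.
  have h := rich_on_zeros YA conS lD.
  have hn : n <= n `^ a by rewrite le1r_powR // /n ler1n.
  have n1 : 1 <= n by rewrite /n ler1n.
  apply: (@le_trans _ _ ((#|A| * D + S * S)%:R)); first by rewrite ler_nat.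
  rewrite !natrD natrM -/n; set d : R := D%:R; set s : R := (S * S)%:R.
  have d0 : 0 <= d by rewrite /d. have s0 : 0 <= s by rewrite /s.
  rewrite mulrDl lerD //; first by rewrite mulrC ler_wpM2l.
  by rewrite ler_peMr // (le_trans n1).
have off_zeros : (#|Y :\: Z|%:R : R) <= C / 4 * n `^ a + q / 2.
  pose Yb b := [set x in Y :\: Z | k x == b].
  have -> : #|Y :\: Z| = (\sum_b #|Yb b|)%N.
    rewrite -sum1_card (partition_big k xpredT) //=; apply: eq_bigr => b _.
    by rewrite sum1dep_card; apply: eq_card => x; rewrite !inE.
  (* One bound for both kinds of cells: the first term is the induction hypothesis for a light cell;
     in a heavy cell the second term is at least [q / M]. Summed over the cells, the second terms
     give at most [q / 2]. *)
  have each b : (#|Yb b|%:R : R) <= C * (r `^ a * n `^ a) +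
      q / (2 * D.+1%:R * n) * #|cell_lines Z k A b|%:R.
    set c : R := #|cell_lines Z k A b|%:R.
    have den0 : 0 < 2 * D.+1%:R * n by rewrite !mulr_gt0 // ltr0n.
    have c0 : 0 <= c by rewrite /c.
    have w0 : 0 <= q / (2 * D.+1%:R * n) by rewrite divr_ge0 // ltW.
    have [small|big] := leP c (r * n).
      have r0 : 0 <= r by rewrite /r divr_ge0 // ?mulr_ge0.
      apply: (@le_trans _ _ (C * c `^ a)); last first.
        rewrite -powRM ?(ltW nA0) // -[X in X <= _]addr0 lerD ?(mulr_ge0 w0 c0) //.
        rewrite ler_wpM2l //; apply: ge0_ler_powR => //;
          rewrite ?nnegrE ?mulr_ge0 ?(ltW nA0) //.
        exact: le_trans ler01 a1.
      apply: IH.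
        apply: leq_trans Am; rewrite -(ltr_nat R); apply: le_lt_trans small _.
        by rewrite -/n -[X in _ < X]mul1r ltr_pM2r.
      move=> x; rewrite !inE => /andP[/andP[xZ /YA/exists_inP[l lA]] + xb].
      case/exists_inP=> l' l'A /and3P[ll' xl xl'].
      apply/exists_inP; exists l.
        by rewrite inE lA /=; apply/existsP; exists x; rewrite xZ xl.
      apply/exists_inP; exists l'; last by rewrite ll' xl.
      by rewrite inE l'A /=; apply/existsP; exists x; rewrite xZ xl'.
    rewrite -[X in X <= _]add0r lerD ?mulr_ge0 ?powR_ge0 //.
    have /= h : #|Yb b|%:R * M%:R <= q by rewrite -natrM ler_nat cell.
    rewrite -(ler_pM2r M_gt0); apply: (le_trans h).
    rewrite [X in _ <= X](_ : _ = q * (c * M%:R / (2 * D.+1%:R * n))); last by ring.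
    rewrite ler_peMr // ler_pdivlMr // mul1r.
    by move: big; rewrite /r mulrAC ltr_pdivrMr // => /ltW.
  rewrite natr_sum; apply: (le_trans (ler_sum _ (fun b _ => each b))).
  rewrite big_split /= sumr_const -mulr_sumr -natr_sum lerD //.
    rewrite -mulr_natl -/M.
    rewrite [X in X <= _](_ : _ = M%:R * r `^ a * (C * n `^ a)); last by ring.
    rewrite [X in _ <= X](_ : _ = 1 / 4 * (C * n `^ a)); last by field.
    by rewrite ler_wpM2r // mulr_ge0 ?powR_ge0.
  have h : (\sum_b #|cell_lines Z k A b|)%:R <= n * D.+1%:R :> R.
    by rewrite /n -natrM ler_nat sum_cell_lines.
  apply: (@le_trans _ _ (q / (2 * D.+1%:R * n) * (n * D.+1%:R))).
    by rewrite ler_wpM2l // divr_ge0 // !mulr_ge0 // ltW.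
  have n0 : n != 0 by rewrite gt_eqF. have D0 : D.+1%:R != 0 :> R by rewrite pnatr_eq0.
  by rewrite le_eqVlt; apply/orP; left; apply/eqP; field; rewrite n0 nat1r D0.
(* With [p] the power of [n], the zeros and the light cells cost [C / 4 * p] each, so
   [q <= C / 2 * p + q / 2]; this is why [C] has the factor 4. *)
have qE : q = #|Y :&: Z|%:R + #|Y :\: Z|%:R by rewrite -natrD cardsID.
move: q0 on_zeros off_zeros qE; rewrite /C.
move: (n `^ a) ((D + S * S)%:R : R) (#|Y :&: Z|%:R : R) (#|Y :\: Z|%:R : R) q.
by move=> {}p {}e x y {}q *; lra.
Qed.

End Induction.

(** * Choice of the degree *)

(** Here [u] stands for [2 ^ I]. The exponent [3 / 2] turns [u ^- 2] into [u ^- 3], which cancels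
    the number of cells, and [eps] leaves a gain of [u] to the power [- 2 * eps] against the
    constant. *)
Lemma cell_weight_le (R : realType) (eps u r : R) : 0 < eps -> 1 <= u ->
  4 * 38 `^ (3 / 2 + eps) <= u `^ (2 * eps) -> 0 <= r -> r <= 38 / u ^+ 2 ->
  u ^+ 3 * r `^ (3 / 2 + eps) <= 1 / 4.
Proof.
move=> e0 u1; set a := 3 / 2 + eps => Bu r0 ru.
have u0 : 0 < u by exact: lt_le_trans ltr01 u1.
have a0 : 0 <= a by rewrite /a; lra.
have u_ne0 : u != 0 by rewrite gt_eqF.
have upos : 0 < u `^ (2 * eps) by rewrite powR_gt0.
have h : r `^ a <= 38 `^ a / (u ^+ 3 * u `^ (2 * eps)).
  apply: (@le_trans _ _ ((38 / u ^+ 2) `^ a)).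
    by apply: ge0_ler_powR; rewrite ?nnegrE ?divr_ge0 ?exprn_ge0 ?(ltW u0).
  rewrite powRM ?invr_ge0 ?exprn_ge0 ?(ltW u0) // ler_wpM2l ?powR_ge0 //.
  rewrite -!powR_mulrn ?(ltW u0) // -powRD; last by rewrite u_ne0 implybT.
  rewrite -!powR_inv1 ?powR_ge0 // -!powRrM le_eqVlt; apply/orP; left; apply/eqP.
  by congr (_ `^ _); rewrite /a; field.
apply: (@le_trans _ _ (u ^+ 3 * (38 `^ a / (u ^+ 3 * u `^ (2 * eps))))).
  by rewrite ler_wpM2l // exprn_ge0 // ltW.
have -> : u ^+ 3 * (38 `^ a / (u ^+ 3 * u `^ (2 * eps))) = 38 `^ a / u `^ (2 * eps).
  by field; rewrite u_ne0 gt_eqF.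
rewrite ler_pdivrMr //; move: Bu; move: (38 `^ a) (u `^ (2 * eps)) => x y; lra.
Qed.

Lemma exists_partition_exponent (R : realType) (eps : R) : 0 < eps ->
  exists I : nat, let M : R := (2 ^ (3 * I))%:R in
  let r : R := 2 * (18 * 2 ^ I).+1%:R / M in
  r < 1 /\ M * r `^ (3 / 2 + eps) <= 1 / 4.
Proof.
move=> e0; pose B : R := 4 * 38 `^ (3 / 2 + eps).
have B0 : 0 < B by rewrite /B mulr_gt0 // powR_gt0.
have ee : 1 / (2 * eps) * (2 * eps) = 1 by field; rewrite gt_eqF.
have e2 : 0 <= 2 * eps by lra.
have a1 : 1 <= 3 / 2 + eps by lra.
have [I BI] : exists I : nat, B `^ (1 / (2 * eps)) < I%:R.
  by exists (Num.bound (B `^ (1 / (2 * eps)))); apply: archi_boundP; exact: powR_ge0.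
exists I => M r.
have ME : M = (2 ^ I)%:R ^+ 3 by rewrite /M -natrX -expnM mulnC.
have M1 : 1 <= M by rewrite /M ler1n expn_gt0.
have u1 : 1 <= (2 ^ I)%:R :> R by rewrite ler1n expn_gt0.
have Iu : I%:R <= (2 ^ I)%:R :> R by rewrite ler_nat ltnW // ltn_expl.
have rE : r = 2 * (18 * (2 ^ I)%:R + 1) / M.
  by rewrite /r -[(18 * 2 ^ I).+1%:R]natr1 natrM.
move: M r ME M1 rE u1 Iu BI; move: (2 ^ I)%:R I%:R => u i M r ME M1 -> u1 iu Bi.
have u0 : 0 < u by exact: lt_le_trans ltr01 u1.
have Bu : B <= u `^ (2 * eps).
  have -> : B = B `^ (1 / (2 * eps)) `^ (2 * eps) by rewrite -powRrM ee powRr1 // ltW.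
  by apply: ge0_ler_powR; rewrite ?nnegrE ?powR_ge0 ?(ltW u0) // (le_trans (ltW Bi)).
have r0 : 0 <= 2 * (18 * u + 1) / M by rewrite divr_ge0; lra.
(* The constant 38 comes from [2 * (18 * u + 1) <= 38 * u]. *)
have last : M * (2 * (18 * u + 1) / M) `^ (3 / 2 + eps) <= 1 / 4.
  rewrite [X in X * _]ME; apply: cell_weight_le => //.
  have -> : 38 / u ^+ 2 = 38 * u / M by rewrite ME; field; rewrite gt_eqF.
  by rewrite ler_pM2r ?invr_gt0; lra.
(* If [r] were at least 1, so would be its power and the product with [M], against the bound
   [1 / 4]. *)
split=> //; rewrite ltNge; apply/negP => r1.
have ra := le1r_powR r1 a1.
have := ler_pM ler01 ler01 M1 (le_trans r1 ra); lra.
Qed.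

(** * Lines in space *)

Section GeometricPartition.
Variables (R : realType) (X T : finType) (pt : X -> 'rV[R]_3) (la lv : T -> 'rV[R]_3).
Variables (inc : X -> T -> bool) (S D : nat).
Hypotheses (pt_inj : injective pt)
  (incP : forall x l, inc x l -> exists t, pt x = la l + t *: lv l).
Hypothesis surface : forall p : mpoly 3 R, p != 0 -> msize p = D.+1 ->
  (#|[set l | `[< forall t, eval_at (la l + t *: lv l) p = 0%R >]]| <= S)%N.

(** The hypothesis on surfaces concerns degree exactly [D], so the product of [ps] is multiplied by
    a power of a coordinate. *)
Lemma pad_degree (ps : seq (mpoly 3 R)) : all (fun p => p != 0) ps ->
  (total_degree ps <= D)%N -> exists P : mpoly 3 R, [/\ P != 0, msize P = D.+1 &
    forall x, has (fun p => eval_at x p == 0) ps -> eval_at x P = 0].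
Proof.
move=> nz deg; pose P0 := \prod_(p <- ps) p.
have [P00 sP0] : P0 != 0 /\ msize P0 = (total_degree ps).+1.
  rewrite /P0 /total_degree; elim: ps nz {deg P0} => [_|p ps IH /= /andP[p0 /IH[h1 h2]]].
    by rewrite !big_nil oner_neq0 mmeasure1.
  rewrite !big_cons mulf_neq0 // msizeM // h2 addnS /= -addSn prednK //.
  by rewrite lt0n mmeasure_poly_eq0.
pose Q : mpoly 3 R := mpolyX R (mnm_muln (mnm1 (0 : 'I_3)) (D - total_degree ps)).
have sQ : msize Q = (D - total_degree ps).+1.
  by rewrite /Q msizeX mdegMn mdeg1 mul1n.
have Q0 : Q != 0 by rewrite -(mmeasure_poly_eq0 (@mdeg 3)) sQ.
exists (P0 * Q); split; first by rewrite mulf_neq0.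
  by rewrite msizeM // sP0 sQ addSn addnS /= subnKC.
move=> x /hasP[p pps /eqP px]; rewrite /eval_at rmorphM rmorph_prod /=.
by rewrite (big_rem p) //= -/(eval_at x p) px !mul0r.
Qed.

Lemma geometric_partition (I N : nat) (Y : {set X}) :
  N = (3 * I)%N -> (18 * 2 ^ I <= D)%N ->
  exists (Z : {set X}) (con : {set T}) (k : X -> N.-tuple bool),
  [/\ (#|con| <= S)%N,
      forall b, (#|[set x in Y :\: Z | k x == b]| * #|{: N.-tuple bool}| <= #|Y|)%N,
      forall l, l \notin con -> (#|[set x in Z | inc x l]| <= D)%N &
      forall l, (#|[set b | [exists x, [&& x \notin Z, inc x l & k x == b]]]| <= D.+1)%N].
Proof.
move=> -> hD; have [ps [sz nz deg part]] :=
  polynomial_partition (fun x : {x in Y} => pt (val x)) I.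
have degD := leq_trans deg hD.
rewrite -sz.
pose Z := [set x | ~~ off_zeros ps (pt x)].
pose con := [set l | has (fun p => restrict_line (la l) (lv l) p == 0) ps].
pose k x : (size ps).-tuple bool :=
  Tuple (introT eqP (size_map (fun p => 0 < eval_at (pt x) p) ps)).
exists Z, con, k.
have param l : exists f : X -> R,
    forall x, x \in [set x | inc x l] -> pt x = la l + f x *: lv l.
  apply: (@fin_all_exists _ _
    (fun x t => x \in [set x | inc x l] -> pt x = la l + t *: lv l)).
  move=> x; rewrite inE; case: (boolP (inc x l)) => [/incP[t ->]|_]; first by exists t.
  by exists 0.
have nzl l : l \notin con -> all (fun p => restrict_line (la l) (lv l) p != 0) ps.
  by rewrite inE -all_predC.
split.
- have [P [P0 sP hP]] := pad_degree nz degD.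
  apply: leq_trans (surface P0 sP); apply: subset_leq_card; apply/fintype.subsetP => l.
  rewrite !inE => /hasP[p pps /eqP pl]; apply/asboolP => t; apply: hP.
  by apply/hasP; exists p; rewrite // -horner_restrict_line pl horner0.
- move=> b; have := part b; rewrite card_tuple card_bool card_sig.
  have -> : #|[set x in Y :\: Z | k x == b]| =
    #|[set x : {x in Y} | off_zeros ps (pt (val x)) & sign_pattern ps (pt (val x)) == b]|.
    rewrite -(card_imset _ val_inj); apply: eq_card => x.
    apply/idP/imsetP => [|[y + ->]]; rewrite !inE ?negbK.
      move=> /andP[/andP[ox xY] xb].
      by exists (exist _ x xY) => //; rewrite inE /= ox -[_ == _]/(k x == b).
    by move=> /andP[-> yb]; rewrite (valP y) /= -val_eqE.
  by [].
- move=> l /nzl lnz; have [f fE] := param l.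
  apply: leq_trans degD; apply: leq_trans (line_zeros fE lnz pt_inj).
  by apply: subset_leq_card; apply/fintype.subsetP => x; rewrite !inE andbC.
(* A line of [con] never leaves the zero set, so it enters no cell. *)
- move=> l; have [lc|/nzl lnz] := boolP (l \in con).
    rewrite eq_card0 // => b; apply/negP; rewrite inE => /existsP[x /and3P[xZ xl _]].
    move: xZ lc; rewrite !inE negbK => /allP ox /hasP[p pps /eqP pl].
    have [t xE] := incP xl.
    by have := ox p pps; rewrite xE -horner_restrict_line pl horner0 eqxx.
  have [f fE] := param l.
  apply: leq_trans (leq_trans (line_cells fE lnz) _); last by rewrite ltnS.
  apply: subset_leq_card; apply/fintype.subsetP => b; rewrite !inE => /existsP[x].
  rewrite inE negbK => /and3P[ox xl xb]; apply/exists_inP; exists x; rewrite ?inE //.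
  by rewrite ox -[_ == _]/(k x == b).
Qed.

End GeometricPartition.

Local Open Scope classical_set_scope.
Local Open Scope card_scope.
Local Open Scope ring_scope.

Lemma line_through_two_points (R : realType) (l : set 'rV[R]_3) x y :
  is_line l -> l x -> l y -> x <> y ->
  l = [set x + t *: (y - x) | t in [set: R]].
Proof.
move=> [a [v [v0 ->]]] [t _ <-] [s _ <-] xy.
have ts : s - t != 0 by rewrite subr_eq0; apply/eqP => e; apply: xy; rewrite e.
have dE : a + s *: v - (a + t *: v) = (s - t) *: v.
  by rewrite scalerBl opprD addrACA subrr add0r.
rewrite dE; apply/seteqP; split => _ [r _ <-] /=.
  exists ((r - t) / (s - t)) => //.
  by rewrite scalerA divfK // -addrA -scalerDl [t + _]addrC subrK.
exists (t + r * (s - t)) => //.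
by rewrite scalerA -addrA -scalerDl.
Qed.

Lemma lines_meet_once (R : realType) (l l' : set 'rV[R]_3) x y :
  is_line l -> is_line l' -> l <> l' -> l x -> l' x -> l y -> l' y -> x = y.
Proof.
move=> ll ll' ne lx lx' ly ly'; apply: contrapT => xy; apply: ne.
by rewrite (line_through_two_points ll lx ly xy) (line_through_two_points ll' lx' ly' xy).
Qed.

(** A rich point is the only common point of two of the lines, hence a value of [F]; 0 is the
    default for pairs that do not meet. *)
Lemma finite_two_rich_points (R : realType) (Ls : set (set 'rV[R]_3)) :
  (forall l, Ls l -> is_line l) -> finite_set Ls -> finite_set (two_rich_points Ls).
Proof.
move=> isl fin.
pose F (p : set 'rV[R]_3 * set 'rV[R]_3) := xget 0 (p.1 `&` p.2).
apply: (@sub_finite_set _ _ (F @` (Ls `*` Ls))); last first.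
  by apply: finite_image; exact: finite_setX.
move=> x [l1 [l2 [h1 h2 ne x1 x2]]]; exists (l1, l2) => //=.
have [y1 y2] : (l1 `&` l2) (F (l1, l2)) by apply: xgetPex; exists x.
exact: (lines_meet_once (isl _ h1) (isl _ h2) ne).
Qed.

Theorem theorem0p5 (R : realType) (eps : R) (heps : 0 < eps) :
  exists D : nat, forall S : nat, exists C : R,
    forall (L : nat) (Ls : set (set 'rV[R]_3)),
      (forall l, Ls l -> is_line l) ->
      Ls #= `I_L ->
      (forall Z : set 'rV[R]_3, algebraic_surface D Z ->
         [set l | Ls l /\ l `<=` Z] #<= `I_S) ->
      finite_set (two_rich_points Ls) /\
      #|` fset_set (two_rich_points Ls)|%:R
        <= C * L%:R `^ (3 / 2 + eps).
Proof.
have [I [r1 Mr]] := exists_partition_exponent heps.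
exists (18 * 2 ^ I)%N => S; set D := (18 * 2 ^ I)%N in r1 Mr *.
exists (4 * (D + S * S)%:R) => L Ls isl cardL surf.
have finL : finite_set Ls by apply/finite_setP; exists L.
have finX := finite_two_rich_points isl finL; split=> //.
pose T : finType := fset_set Ls; pose X : finType := fset_set (two_rich_points Ls).
have LsT (l : T) : Ls (val l).
  by have := valP l; rewrite in_fset_set // inE.
have TLs l : Ls l -> l \in fset_set Ls by rewrite in_fset_set // inE.
have /choice[par parE] (l : T) : exists p : 'rV[R]_3 * 'rV[R]_3,
    val l = [set p.1 + t *: p.2 | t in [set: R]].
  by have [a [v [_ lE]]] := isl _ (LsT l); exists (a, v).
pose inc (x : X) (l : T) := `[< val l (val x) >].
have -> : L = #|[set: T]%SET| by rewrite cardsT -(card_fset_set cardL) cardfE.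
have -> : #|` fset_set (two_rich_points Ls)| = #|[set: X]%SET| by rewrite cardsT cardfE.
have cardB : #|{: (3 * I).-tuple bool}| = (2 ^ (3 * I))%N by rewrite card_tuple card_bool.
(* Applied to all the lines and all the rich points, with sign patterns as cells. *)
apply: (@rich_bound _ _ ((3 * I).-tuple bool) inc S D); rewrite ?cardB ?expn_gt0 //.
- move=> l l' x x' /eqP ll' /asboolP h1 /asboolP h2 /asboolP h3 /asboolP h4.
  apply: val_inj; apply: (lines_meet_once (isl _ (LsT l)) (isl _ (LsT l'))) => //.
  by move=> /val_inj.
- by lra.
- rewrite -cardB => Y.
  apply: (@geometric_partition R X T val (fun l => (par l).1) (fun l => (par l).2)
    inc S D val_inj _ _ I) => //.
    by move=> x l /asboolP; rewrite parE => -[t _ <-]; exists t.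
  move=> p p0 sp.
  have := geq_card_fset_set (surf (zero_locus p) (ex_intro _ p (And3 p0 sp erefl))).
  apply: leq_trans; rewrite cardE -(size_map val).
  apply: uniq_leq_size; first by rewrite map_inj_uniq ?enum_uniq //; exact: val_inj.
  move=> _ /mapP[l + ->]; rewrite mem_enum inE => /asboolP h.
  rewrite in_fset_set ?inE; last by apply: sub_finite_set finL => ? [].
  split; first exact: LsT.
  by rewrite parE => _ [t _ <-]; apply: h.
move=> x _; have := valP x; rewrite in_fset_set // inE => -[l1 [l2 [h1 h2 ne x1 x2]]].
apply/exists_inP; exists [` TLs _ h1]%fset; first by rewrite inE.
apply/exists_inP; exists [` TLs _ h2]%fset; first by rewrite inE.
apply/and3P; split; [|exact/asboolP|exact/asboolP].
by apply/eqP => /(congr1 val).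
Qed.
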